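(* Let $\mathcal{M}$ be an embedded Riemannian submanifold of $\mathbb{R}^n$ with $\dim(\mathcal{M})=d$ and let $1\le k<d$. Then: (i) $\mathrm{St}_k(\mathrm{T}\mathcal{M})$ is an embedded Riemannian submanifold of $\mathbb{R}^n\times\mathbb{R}^{n\times k}$ with $\dim(\mathrm{St}_k(\mathrm{T}\mathcal{M}))=d+kd-\frac{k(k+1)}{2}$. (ii) $\mathrm{Gr}_k(\mathrm{T}\mathcal{M})$ is an embedded Riemannian submanifold of $\mathbb{R}^n\times\mathbb{R}^{n\times n}_{\mathrm{sym}}$ with $\dim(\mathrm{Gr}_k(\mathrm{T}\mathcal{M}))=d+k(d-k)$.
   Context: Stiefel and Grassmann bundles of the tangent bundle: $$\mathrm{St}_k(\mathrm{T}\mathcal{M}):=\{(\mathbf{x},V)\mid\mathbf{x}\in\mathcal{M},\ V\in\mathrm{St}_k(\mathrm{T}_{\mathbf{x}}\mathcal{M})\},\qquad \mathrm{Gr}_k(\mathrm{T}\mathcal{M}):=\{(\mathbf{x},P)\mid\mathbf{x}\in\mathcal{M},\ P\in\mathrm{Gr}_k(\mathrm{T}_{\mathbf{x}}\mathcal{M})\}.$$ Here $\mathrm{St}_k(\mathrm{T}_{\mathbf{x}}\mathcal{M})$ is the set of ordered $k$-tuples of orthonormal vectors of $\mathrm{T}_{\mathbf{x}}\mathcal{M}\subset\mathbb{R}^n$, written as matrices $V\in\mathbb{R}^{n\times k}$ with $V^\top V=I_k$ and columns in $\mathrm{T}_{\mathbf{x}}\mathcal{M}$; $\mathrm{Gr}_k(\mathrm{T}_{\mathbf{x}}\mathcal{M})$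 is the set of $k$-dimensional subspaces of $\mathrm{T}_{\mathbf{x}}\mathcal{M}$, each identified with the orthogonal projector onto it, i.e. $P\in\mathbb{R}^{n\times n}_{\mathrm{sym}}$ with $P^2=P$, $\mathrm{rank}(P)=k$, $\mathrm{Ran}(P)\subseteq\mathrm{T}_{\mathbf{x}}\mathcal{M}$. $\mathbb{R}^{n\times n}_{\mathrm{sym}}$ is the space of real symmetric $n\times n$ matrices. ''Embedded Riemannian submanifold'' means smooth embedded submanifold with the metric induced from the ambient Euclidean space. *)

(* Defs.v *)
From HB Require Import structures.
From mathcomp Require Import all_boot all_order all_algebra.
From mathcomp Require Import all_classical reals topology normedtype derive.

Set Implicit Arguments.
Unset Strict Implicit.
Unset Printing Implicit Defensive.

Import Order.TTheory GRing.Theory Num.Theory.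
Import numFieldNormedType.Exports.

Local Open Scope classical_set_scope.
Local Open Scope ring_scope.

(* The canonical norm on matrices is the maximum norm; in finite dimension the
   topology, hence smoothness, does not depend on the norm. The Euclidean inner
   products are introduced separately below. *)
#[short(type="finNormedModType")]
HB.structure Definition FinNormedModule (R : numFieldType) :=
  {E of NormedModule R E & Vector R E}.

HB.instance Definition _ (R : numFieldType) (m n : nat) :=
  NormedModule.on 'M[R]_(m, n).

HB.instance Definition _ (R : numFieldType) := NormedModule.on R^o.

HB.instance Definition _ (R : numFieldType) (E F : finNormedModType R) :=
  NormedModule.on (E * F)%type.

(* Real symmetric matrices, with the norm inherited from 'M[R]_n. *)
Section SymmetricMatrices.
Variables (R : realType) (n : nat).

Definition sym_vspace : {vspace 'M[R]_n} := fixedSpace (linfun (@trmx R n n)).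

Lemma mem_sym_vspace (A : 'M[R]_n) : (A \in sym_vspace) = (A^T == A).
Proof. by apply/fixedSpaceP/eqP; rewrite lfunE. Qed.

Definition symmx : predArgType := subvs_of sym_vspace.

HB.instance Definition _ := Vector.on symmx.

Definition mx_of_sym (A : symmx) : 'M[R]_n := vsval A.

Let sym_norm (A : symmx) : R := `|mx_of_sym A|.

Let sym_normD (A B : symmx) : sym_norm (A + B) <= sym_norm A + sym_norm B.
Proof. exact: ler_normD. Qed.

Let sym_normZ (a : R) (A : symmx) : sym_norm (a *: A) = `|a| * sym_norm A.
Proof. exact: normrZ. Qed.

Let sym_norm0_eq0 (A : symmx) : sym_norm A = 0 -> A = 0.
Proof. by move/normr0_eq0 => A0; apply: subvs_inj. Qed.

HB.instance Definition _ :=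
  Lmodule_isNormed.Build R symmx sym_normD sym_normZ sym_norm0_eq0.

End SymmetricMatrices.

Section Submanifolds.
Variable R : realType.

(* C^k on an open set U, for maps between finite-dimensional spaces: continuity
   of the differential as an operator-valued map is equivalent to continuity of
   x |-> 'd f x v for each fixed v. *)
Fixpoint Ck_on (E F : finNormedModType R) (k : nat) (U : set E) (f : E -> F)
    : Prop :=
  if k is k'.+1 then
    (forall x, U x -> differentiable f x) /\
    (forall v : E, Ck_on k' U (fun x => 'd f x v))
  else forall x, U x -> {for x, continuous f}.

Definition smooth_on (E F : finNormedModType R) (U : set E) (f : E -> F) :=
  forall k, Ck_on k U f.

(* Local defining functions: near each of its points, M is the zero set of a
   smooth map h into R^c, c = dim E - d, whose differential has rank c. For
   c = 0 this says that M is open. M is nonempty, so that its dimension d is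
   determined by M. *)
Definition embedded_submanifold (E : finNormedModType R) (M : set E) (d : nat) :=
  M !=set0 /\
  exists2 c : nat, (d + c = dim E)%N &
  forall x, M x -> exists (U : set E) (h : E -> 'cV[R]_c),
    [/\ open U /\ U x, smooth_on U h,
        forall y, U y -> (h y = 0 <-> M y) &
        \dim (limg (linfun ('d h x))) = c].

Definition tangent_space (E : finNormedModType R) (M : set E) (x : E) : set E :=
  [set v | exists (e : R) (c : R^o -> E),
    [/\ 0 < e, smooth_on (ball (0 : R^o) e) c,
        forall t, ball (0 : R^o) e t -> M (c t), c 0 = x & (c^`())%classic 0 = v]].

(* A metric on M is a family g of forms, g x being relevant on the tangent
   space at x only; ip is the inner product of the ambient Euclidean space. *)
Definition embedded_riemannian_submanifold (E : finNormedModType R)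
    (ip : E -> E -> R) (M : set E) (g : E -> E -> E -> R) (d : nat) :=
  embedded_submanifold M d /\
  forall x u v, M x -> tangent_space M x u -> tangent_space M x v ->
    g x u v = ip u v.

Definition frobenius m n (A B : 'M[R]_(m, n)) : R := \tr (A^T *m B).

Definition ip_stiefel n k (p q : 'cV[R]_n * 'M[R]_(n, k)) : R :=
  frobenius p.1 q.1 + frobenius p.2 q.2.

Definition ip_grassmann n (p q : 'cV[R]_n * symmx R n) : R :=
  frobenius p.1 q.1 + frobenius (mx_of_sym p.2) (mx_of_sym q.2).

Definition stiefel_bundle n (k : nat) (M : set 'cV[R]_n)
    : set ('cV[R]_n * 'M[R]_(n, k)) :=
  [set p | [/\ M p.1, p.2^T *m p.2 = 1%:M &
               forall j : 'I_k, tangent_space M p.1 (col j p.2)]].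

(* A k-dimensional subspace of the tangent space is identified with the
   orthogonal projector onto it. *)
Definition grassmann_bundle n (k : nat) (M : set 'cV[R]_n)
    : set ('cV[R]_n * symmx R n) :=
  [set p | [/\ M p.1, mx_of_sym p.2 *m mx_of_sym p.2 = mx_of_sym p.2,
               \rank (mx_of_sym p.2) = k &
               forall v : 'cV[R]_n, tangent_space M p.1 (mx_of_sym p.2 *m v)]].

End Submanifolds.

Arguments stiefel_bundle {R n} k M.
Arguments grassmann_bundle {R n} k M.

(* Main.v *)
(* Near each of its points [M] is the zero set of a submersion [h]; along [M] its
   tangent space is [ker (dh)]. One inclusion is the chain rule; for the other, a
   curve in [M] with a given velocity comes from a contraction argument, and it
   is smooth because it satisfies a differential equation [c' = f c], [f] smooth.
   The two bundles are then zero sets of explicit submersions.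
   - Stiefel: [(x, V) |-> (h x, dh_x V, V^T V - 1)].
   - Grassmann, near [(x0, P0)]: with [P0 = V0 R0] and [1 - P0 = V1 R1] full-rank
     factorizations and [N = P^2 - P], the map
     [(x, P) |-> (h x, dh_x P V0, R0 N R0^T, R1 N R1^T)]. For [P] near [P0], the
     vanishing of the two diagonal blocks of [N] forces [N = 0]. *)
Require Import Defs.
From HB Require Import structures.
From mathcomp Require Import all_boot all_order all_algebra.
From mathcomp Require Import all_classical reals topology normedtype derive.
From mathcomp Require Import landau interval_inference sequences ring lra zify.

Set Implicit Arguments.
Unset Strict Implicit.
Unset Printing Implicit Defensive.

Import Order.TTheory GRing.Theory Num.Theory.
Import numFieldNormedType.Exports.
Import VectorInternalTheory.

Local Open Scope classical_set_scope.
Local Open Scope ring_scope.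

(** Tangent vectors are velocities of smooth curves, so a vector of [ker (dh)] has to be realized by
    a curve that is smooth to every order. The fixed points only yield a Lipschitz curve; that it is
    differentiable follows from [h] vanishing along it, and only then can the differential equation
    raise its regularity, one order at a time. For the Grassmann bundle, [P^2 = P] taken as it
    stands does not define a submersion: at a projector [P0] the differential
    [Z |-> P0 Z + Z P0 - Z] of [N] is the identity on the block of [P0], minus the identity on the
    block of [1 - P0], and zero on the two mixed blocks. This is why only the diagonal blocks of [N]
    are imposed. In the same way [dh_x P] is multiplied by [V0], which keeps [c * k] independent
    equations. Surjectivity of the differentials rests on a right inverse of [dh] whose image is
    orthogonal to the kernel: corrections of different components then do not interfere. *)

(** * Boundedness of linear maps in finite dimension *)

Section LinearMaps.
Variable R : realType.

Lemma mx_coord_le (m n : nat) (u : 'M[R]_(m, n)) i j : `|u i j| <= `|u|.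
Proof.
rewrite [leRHS]/Num.norm/= mx_normrE.
exact: (le_bigmax _ (fun ij => `|u ij.1 ij.2|) (i, j)).
Qed.

Lemma mx_norm_le (m n : nat) (u : 'M[R]_(m, n)) (e : R) :
  0 <= e -> (forall i j, `|u i j| <= e) -> `|u| <= e.
Proof.
by move=> e0 ue; rewrite [leLHS]/Num.norm/= mx_normrE; apply/bigmax_leP; split.
Qed.

Lemma mx_linear_bounded (m n : nat) (F : normedModType R)
    (f : {linear 'M[R]_(m, n) -> F}) :
  exists2 C, 0 < C & forall u, `|f u| <= C * `|u|.
Proof.
exists (1 + \sum_(i < m) \sum_(j < n) `|f (delta_mx i j)|) => [|u].
  by rewrite ltr_pwDl// sumr_ge0// => i _; rewrite sumr_ge0.
rewrite mulrDl mul1r ler_wpDl//.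
rewrite [in leLHS](matrix_sum_delta u) raddf_sum/=.
rewrite (le_trans (ler_norm_sum _ _ _))//.
rewrite mulr_suml ler_sum// => i _; rewrite raddf_sum/=.
rewrite (le_trans (ler_norm_sum _ _ _))//.
rewrite mulr_suml ler_sum// => j _; rewrite linearZ/= normrZ mulrC ler_wpM2l//.
exact: mx_coord_le.
Qed.

Lemma bounded_continuous (E F : normedModType R) (f : {linear E -> F}) :
  (exists2 C, 0 < C & forall u, `|f u| <= C * `|u|) -> continuous f.
Proof.
move=> [C C0 fC]; apply/linear_bounded_continuous/linear_boundedP.
near=> r => x; rewrite (le_trans (fC x))// ler_wpM2r//.
Unshelve. all: by end_near. Qed.

(** The norm of [E] is arbitrary, so it has to be compared with the maximum norm of coordinates:
    [|r2v u|] attains a minimum on the compact unit sphere, positive because [r2v] is injective, and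
    homogeneity does the rest. *)
Lemma linear_bounded (E : finNormedModType R) (F : normedModType R)
    (f : {linear E -> F}) :
  exists2 C, 0 < C & forall u, `|f u| <= C * `|u|.
Proof.
have [C C0 HC] := mx_linear_bounded (f \o r2v).
have [D D0 HD] := mx_linear_bounded (r2v : {linear _ -> E}).
suff [m m0 Hm] : exists2 m, 0 < m &
    forall u : 'rV[R]_(dim E), m * `|u| <= `|r2v u : E|.
  exists (C / m) => [|x]; first by rewrite divr_gt0.
  have := HC (v2r x); rewrite /= v2rK => /le_trans; apply.
  rewrite -mulrA ler_pM2l// ler_pdivlMl//.
  by rewrite (le_trans (Hm _))// v2rK.
pose S := [set u : 'rV[R]_(dim E) | `|u| = 1].
have SP u : u != 0 -> S (`|u|^-1 *: u).
  by move=> u0; rewrite /S/= normrZ normfV normr_id mulVf// normr_eq0.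
(* An empty sphere means that [E] is zero-dimensional; any constant then works. *)
have [S0|/set0P S0] := eqVneq S set0.
  exists 1 => // u; have [->|/SP] := eqVneq u 0; first by rewrite normr0 mulr0.
  by rewrite S0.
have cS : compact S.
  apply: bounded_closed_compact.
    exists 1; split; first exact: num_real.
    by move=> x x1 u; rewrite /S/= => ->; exact: ltW.
  rewrite (_ : S = Num.norm @^-1` [set 1]); last by apply/seteqP; split.
  by apply: closed_comp => [u _|]; [exact: norm_continuous | exact: closed_eq].
have cN : continuous (fun u : 'rV[R]_(dim E) => `|r2v u : E|).
  move=> u; apply: continuous_comp; last exact: norm_continuous.
  by apply: bounded_continuous; exists D.
have [c /set_mem Sc Hc] := EVT_min_rV S0 cS (continuous_subspaceT cN).
exists `|r2v c : E|.
  rewrite normr_gt0 raddf_eq0; last exact: r2v_inj.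
  by apply: contra_eq_neq Sc => ->; rewrite normr0 eq_sym oner_eq0.
move=> u; have [->|u0] := eqVneq u 0; first by rewrite normr0 mulr0.
have := Hc _ (mem_set (SP _ u0)); rewrite linearZ/= normrZ normfV normr_id.
by rewrite ler_pdivlMl ?normr_gt0// mulrC.
Qed.

Lemma linear_continuous (E : finNormedModType R) (F : normedModType R)
    (f : {linear E -> F}) : continuous f.
Proof. exact/bounded_continuous/linear_bounded. Qed.

End LinearMaps.

(** * Differentials between finite-dimensional spaces *)

Section Differentials.
Variable R : realType.
Implicit Types E F G H : finNormedModType R.

(** Continuity of [df] is automatic in finite dimension, which leaves only the remainder estimate.
    Differentials that no rule provides are obtained from this form. *)
Lemma is_diffP E F (f : E -> F) (df : {linear E -> F}) x :
  is_diff x f df <->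
  forall e, 0 < e -> \forall h \near 0, `|f (h + x) - f x - df h| <= e * `|h|.
Proof.
have key : f \o shift x = cst (f x) + df +o_ 0 id <->
  forall e, 0 < e -> \forall h \near 0, `|f (h + x) - f x - df h| <= e * `|h|.
  split=> [/eqaddoP fx e e0|fx].
    by have := fx e e0; apply: filterS => h; rewrite /= opprD addrA.
  apply/eqaddoP => e e0; have := fx e e0.
  by apply: filterS => h; rewrite /= opprD addrA.
split=> [[dfx dfE]|/key fx].
  by apply/key; rewrite -dfE; exact: diff_locally.
have dfE : 'd f x = df :> (E -> F) by apply: diff_unique => //; exact: linear_continuous.
split=> //; apply/diff_locallyP; rewrite dfE; split=> //; exact: linear_continuous.
Qed.

Lemma is_diff_near E F (f g df : E -> F) x :
  (\forall y \near x, f y = g y) -> is_diff x f df -> is_diff x g df.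
Proof.
move=> fg dfx; rewrite -(@diff_val _ _ _ _ _ _ _ dfx).
apply/is_diffP => e e0.
have /is_diffP/(_ e e0) : is_diff x f ('d f x) by exact: differentiableP.
have fgx := nbhs_singleton fg; rewrite (near_shift 0) subr0 in fg.
by apply: filterS2 fg => h /= <-; rewrite fgx.
Qed.

Lemma is_diff_linear E F (f : {linear E -> F}) x : is_diff x f f.
Proof.
split; first by apply: linear_differentiable; exact: linear_continuous.
by apply: diff_lin; exact: linear_continuous.
Qed.

Lemma is_diff_line E (a w : E) (t : R^o) :
  is_diff t (fun u : R^o => u *: w + a) (fun u : R^o => u *: w).
Proof.
have lL : linear (fun u : R^o => u *: w) by move=> c u v; rewrite scalerDl scalerA.
pose LM := GRing.isLinear.Build _ _ _ _ _ lL.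
pose L : {linear R^o -> E} := HB.pack (fun u : R^o => u *: w) LM.
apply/(@is_diffP R^o E _ L) => e e0; near=> h.
by rewrite /= opprD addrACA subrr addr0 scalerDl addrK subrr normr0 mulr_ge0// ltW.
Unshelve. all: by end_near. Qed.

Lemma is_diff_comp_linear E F G (L : {linear F -> G}) (f df : E -> F) x :
  is_diff x f df -> is_diff x (L \o f) (L \o df).
Proof. by move=> dfx; apply: is_diff_comp; exact: is_diff_linear. Qed.

(** Expanding the first argument in a basis leaves a finite sum of products of a coordinate with a
    linear map. *)
Lemma bilinear_continuous E F G (b : {bilinear E -> F -> G}) :
  continuous (fun p => b p.1 p.2).
Proof.
have bE p : b p.1 p.2 =
    \sum_(i < \dim {:E}) coord (vbasis {:E}) i p.1 *: b (vbasis {:E})`_i p.2.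
  rewrite {1}(coord_vbasis (memvf p.1)) linear_sumlz; apply: eq_bigr => i _.
  by rewrite linearZl_LR.
rewrite (funext bE) => p; apply: cvg_big => [|i _]; first exact: add_continuous.
apply: cvgZ.
  apply: (continuous_comp (f := fst) (g := coord _ i)); first exact: cvg_fst.
  exact: linear_continuous.
apply: (continuous_comp (f := snd) (g := b _)); first exact: cvg_snd.
exact: linear_continuous.
Qed.

Lemma is_diff_bilin E F G H (b : {bilinear F -> G -> H}) (f df : E -> F)
    (g dg : E -> G) x :
  is_diff x f df -> is_diff x g dg ->
  is_diff x (fun y => b (f y) (g y)) (fun v => b (f x) (dg v) + b (df v) (g x)).
Proof.
move=> dfx dgx.
have bc := @bilinear_continuous _ _ _ b.
apply: (is_diff_comp (f := fun y => (f y, g y)) (g := fun p => b p.1 p.2)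
  (df := fun v => (df v, dg v)) (dg := fun p => b (f x) p.2 + b p.1 (g x))).
split; first exact: differentiable_bilin.
by rewrite diff_bilin.
Qed.

End Differentials.

(** * Calculus of C^k maps *)

Section CkCalculus.
Variable R : realType.
Implicit Types E F G H : finNormedModType R.

Lemma Ck_on_sub E F k (U V : set E) (f : E -> F) :
  U `<=` V -> Ck_on k V f -> Ck_on k U f.
Proof.
move=> UV; elim: k f => [|k IH] f /=; first by move=> cf x /UV; exact: cf.
by move=> [df Cf]; split=> [x /UV|v]; [exact: df | exact: IH].
Qed.

Lemma Ck_onW E F k (U : set E) (f : E -> F) : Ck_on k.+1 U f -> Ck_on k U f.
Proof.
elim: k f => [|k IH] f [df Cf]; last by split=> // v; exact: IH.
by move=> x Ux; exact/differentiable_continuous/df.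
Qed.

Lemma Ck_on_ext E F k (U : set E) (f g : E -> F) :
  open U -> (forall x, U x -> f x = g x) -> Ck_on k U f -> Ck_on k U g.
Proof.
move=> oU; elim: k f g => [|k IH] f g fg.
  move=> cf x Ux; rewrite /prop_for/continuous_at -(fg x Ux).
  apply: cvg_trans (cf x Ux); apply: near_eq_cvg.
  by near=> y; apply: fg; near: y; exact: open_nbhs_nbhs.
move=> [df Cf].
have dg x : U x -> is_diff x g ('d f x).
  move=> Ux; apply: (@is_diff_near _ _ _ f); last exact/differentiableP/df.
  by near=> y; apply: fg; near: y; exact: open_nbhs_nbhs.
split=> [x /dg[]//|v]; apply: IH (Cf v) => x Ux.
by have [_ /(congr1 (@^~ v))/esym] := dg x Ux.
Unshelve. all: by end_near. Qed.

(** The inductive step of the calculus rules: the candidate [df x] is a plain function, so a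
    derivative can be given by its formula without exhibiting it as a linear map. *)
Lemma Ck_onS E F k (U : set E) (f : E -> F) (df : E -> E -> F) :
  open U -> (forall x, U x -> is_diff x f (df x)) ->
  (forall v, Ck_on k U (df ^~ v)) -> Ck_on k.+1 U f.
Proof.
move=> oU fdf Cdf; split=> [x /fdf[]//|v].
by apply: Ck_on_ext (Cdf v) => // x /fdf[_ /(congr1 (@^~ v))/esym].
Qed.

Lemma Ck_on_is_diff E F k (U : set E) (f : E -> F) x :
  Ck_on k.+1 U f -> U x -> is_diff x f ('d f x).
Proof. by move=> [df _] /df; exact: differentiableP. Qed.

Lemma Ck_on_diff E F k (U : set E) (f : E -> F) v :
  Ck_on k.+1 U f -> Ck_on k U (fun x => 'd f x v).
Proof. by move=> [_ Cf]; exact: Cf. Qed.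

Lemma Ck_on_cst E F k (U : set E) (a : F) : open U -> Ck_on k U (fun=> a).
Proof.
move=> oU; elim: k a => [|k IH] a; first by move=> x _; exact: cvg_cst.
by apply: (@Ck_onS _ _ _ _ _ (fun _ _ => 0)) => // x _; exact: is_diff_cst.
Qed.

Lemma Ck_on_comp_linear E F G k (U : set E) (L : {linear F -> G}) (f : E -> F) :
  open U -> Ck_on k U f -> Ck_on k U (fun x => L (f x)).
Proof.
move=> oU; elim: k f => [|k IH] f Cf.
  by move=> x Ux; apply: continuous_comp; [exact: Cf | exact: linear_continuous].
apply: (@Ck_onS _ _ _ _ _ (fun x v => L ('d f x v))) => // [x Ux|v].
  by apply: is_diff_comp_linear; exact: Ck_on_is_diff Cf Ux.
by apply: IH; exact: Ck_on_diff.
Qed.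

Lemma Ck_on_linear E F k (U : set E) (L : {linear E -> F}) :
  open U -> Ck_on k U L.
Proof.
move=> oU; case: k => [|k]; first by move=> x _; exact: linear_continuous.
apply: (@Ck_onS _ _ _ _ _ (fun=> L)) => // [x _|v]; first exact: is_diff_linear.
exact: Ck_on_cst.
Qed.

Lemma Ck_onD E F k (U : set E) (f g : E -> F) :
  open U -> Ck_on k U f -> Ck_on k U g -> Ck_on k U (fun x => f x + g x).
Proof.
move=> oU; elim: k f g => [|k IH] f g Cf Cg.
  by move=> x Ux; apply: cvgD; [exact: Cf | exact: Cg].
apply: (@Ck_onS _ _ _ _ _ (fun x v => 'd f x v + 'd g x v)) => // [x Ux|v].
  by apply: is_diffD; [exact: Ck_on_is_diff Cf Ux | exact: Ck_on_is_diff Cg Ux].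
by apply: IH; exact: Ck_on_diff.
Qed.

Lemma Ck_on_sum E F k (U : set E) I (r : seq I) (P : pred I) (f : I -> E -> F) :
  open U -> (forall i, P i -> Ck_on k U (f i)) ->
  Ck_on k U (fun x => \sum_(i <- r | P i) f i x).
Proof.
move=> oU Cf; elim: r => [|i r IH].
  by apply: (Ck_on_ext _ _ (Ck_on_cst _ _ oU)) => // x _; rewrite big_nil.
have [Pi|Pi] := boolP (P i); last first.
  by apply: Ck_on_ext IH => // x _; rewrite big_cons (negPf Pi).
apply: (Ck_on_ext _ _ (Ck_onD oU (Cf i Pi) IH)) => // x _.
by rewrite big_cons Pi.
Qed.

Lemma Ck_on_bilin E F G H k (U : set E) (b : {bilinear F -> G -> H})
    (f : E -> F) (g : E -> G) :
  open U -> Ck_on k U f -> Ck_on k U g -> Ck_on k U (fun x => b (f x) (g x)).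
Proof.
move=> oU; elim: k f g => [|k IH] f g Cf Cg.
  move=> x Ux; apply: (continuous_comp (f := fun x => (f x, g x))
    (g := fun p => b p.1 p.2)); last exact: bilinear_continuous.
  by apply: cvg_pair; [exact: Cf | exact: Cg].
apply: (@Ck_onS _ _ _ _ _ (fun x v => b (f x) ('d g x v) + b ('d f x v) (g x)))
  => // [x Ux|v].
  by apply: is_diff_bilin; [exact: Ck_on_is_diff Cf Ux | exact: Ck_on_is_diff Cg Ux].
apply: Ck_onD => //; apply: IH.
- exact: Ck_onW Cf.
- exact: Ck_on_diff Cg.
- exact: Ck_on_diff Cf.
- exact: Ck_onW Cg.
Qed.

Lemma scale_is_bilinear F : bilinear_for *:%R *:%R
  (fun (a : R^o) (v : F) => a *: v).
Proof.
split=> [v|a] c x y /=; first by rewrite scalerDl scalerA.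
by rewrite scalerDr !scalerA mulrC.
Qed.

Lemma Ck_onZ E F k (U : set E) (a : E -> R^o) (f : E -> F) :
  open U -> Ck_on k U a -> Ck_on k U f -> Ck_on k U (fun x => a x *: f x).
Proof.
pose bM := bilinear_isBilinear.Build _ _ _ _ _ _ _ (@scale_is_bilinear F).
pose b : {bilinear R^o -> F -> F} :=
  HB.pack (fun (a : R^o) (v : F) => a *: v) bM.
exact: (@Ck_on_bilin E R^o F F k U b).
Qed.

Lemma Ck_on_pair E F G k (U : set E) (f : E -> F) (g : E -> G) :
  open U -> Ck_on k U f -> Ck_on k U g -> Ck_on k U (fun x => (f x, g x)).
Proof.
move=> oU; elim: k f g => [|k IH] f g Cf Cg.
  by move=> x Ux; apply: cvg_pair; [exact: Cf | exact: Cg].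
apply: (@Ck_onS _ _ _ _ _ (fun x v => ('d f x v, 'd g x v))) => // [x Ux|v].
  by apply: is_diff_pair; [exact: Ck_on_is_diff Cf Ux | exact: Ck_on_is_diff Cg Ux].
by apply: IH; exact: Ck_on_diff.
Qed.

(* [Ck_on] only controls the differential along fixed vectors, whence the
   expansion of ['d g x v] in a basis. *)
Lemma Ck_on_comp E F G k (U : set E) (V : set F) (f : F -> G) (g : E -> F) :
  open U -> open V -> (forall x, U x -> V (g x)) ->
  Ck_on k V f -> Ck_on k U g -> Ck_on k U (fun x => f (g x)).
Proof.
move=> oU oV UV; elim: k f g UV => [|k IH] f g UV Cf Cg.
  by move=> x Ux; apply: continuous_comp; [exact: Cg | exact/Cf/UV].
apply: (@Ck_onS _ _ _ _ _ (fun x v => 'd f (g x) ('d g x v))) => // [x Ux|v].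
  have dg := Ck_on_is_diff Cg Ux.
  by apply: is_diff_comp; exact: Ck_on_is_diff Cf (UV x Ux).
have Cdg : Ck_on k U (fun x => 'd g x v) by exact: Ck_on_diff.
pose e (i : 'I_(\dim {:F})) : F := (vbasis {:F})`_i.
pose a i x : R^o := coord (vbasis {:F}) i ('d g x v).
suff: Ck_on k U (fun x => \sum_i a i x *: 'd f (g x) (e i)).
  apply: Ck_on_ext => // x _.
  rewrite [in RHS](coord_vbasis (memvf ('d g x v))) linear_sum.
  by apply: eq_bigr => i _; rewrite linearZ.
apply: Ck_on_sum => // i _.
apply: Ck_onZ => //.
  exact: (@Ck_on_comp_linear _ _ R^o _ _ (coord (vbasis {:F}) i)).
apply: (IH (fun y => 'd f y (e i)) g UV); last exact: Ck_onW Cg.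
exact: Ck_on_diff Cf.
Qed.

End CkCalculus.

(** * Smoothness of matrix operations; Jacobian matrices *)

Section MatrixCalculus.
Variable R : realType.
Implicit Types E F G : finNormedModType R.

Lemma Ck_on_comp_lin E F G k (U : set E) (L : F -> G) (f : E -> F) :
  linear L -> open U -> Ck_on k U f -> Ck_on k U (fun x => L (f x)).
Proof.
move=> lL; pose LM := GRing.isLinear.Build _ _ _ _ L lL.
pose L' : {linear F -> G} := HB.pack L LM.
exact: (@Ck_on_comp_linear _ _ _ _ _ _ L').
Qed.

Lemma Ck_onM E k (U : set E) (a b : E -> R^o) :
  open U -> Ck_on k U a -> Ck_on k U b -> Ck_on k U (fun x => a x * b x : R^o).
Proof. exact: Ck_onZ. Qed.

Lemma Ck_on_prod E k (U : set E) I (r : seq I) (P : pred I) (f : I -> E -> R^o) :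
  open U -> (forall i, P i -> Ck_on k U (f i)) ->
  Ck_on k U (fun x => \prod_(i <- r | P i) f i x : R^o).
Proof.
move=> oU Cf; elim: r => [|i r IH].
  by apply: (Ck_on_ext _ _ (Ck_on_cst _ _ oU)) => // x _; rewrite big_nil.
have [Pi|Pi] := boolP (P i); last first.
  by apply: Ck_on_ext IH => // x _; rewrite big_cons (negPf Pi).
apply: (Ck_on_ext _ _ (Ck_onM oU (Cf i Pi) IH)) => // x _.
by rewrite big_cons Pi.
Qed.

Lemma Ck_onV E k (U : set E) (a : E -> R^o) :
  open U -> (forall x, U x -> a x != 0) -> Ck_on k U a ->
  Ck_on k U (fun x => (a x)^-1 : R^o).
Proof.
move=> oU a0; elim: k => [|k IH] Ca.
  by move=> x Ux; apply: cvgV; [exact: a0 | exact: Ca].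
apply: (@Ck_onS _ _ _ _ _ _
  (* The square of the inverse is split into two factors, to each of which the induction hypothesis
     applies. *)
  (fun x v => - ((a x)^-1 * ((a x)^-1 * 'd a x v)) : R^o)) => // [x Ux|v].
  have [da _] := Ck_on_is_diff Ca Ux.
  split; first exact: differentiableV (a0 x Ux).
  apply: (etrans (diffV da (a0 x Ux))); apply/funext => v.
  by rewrite /= /GRing.scale/= expr2 invfM mulNr mulrA.
have C1 := IH (Ck_onW Ca).
apply: (@Ck_on_comp_lin _ R^o R^o _ _ (fun y => - y)) => //.
  by move=> c y z; rewrite opprD scalerN.
by do 2!(apply: Ck_onM => //); exact: Ck_on_diff.
Qed.

Lemma Ck_on_mxP E k (U : set E) m n (A : E -> 'M[R]_(m, n)) :
  open U -> Ck_on k U A <-> forall i j, Ck_on k U (fun x => A x i j : R^o).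
Proof.
move=> oU; split=> [CA i j|CA].
  apply: (@Ck_on_comp_lin E 'M[R]_(m, n) R^o k U (fun B => B i j : R^o) A) => //.
  by move=> c B B'; rewrite !mxE.
have : Ck_on k U (fun x =>
    \sum_i \sum_j (A x i j : R^o) *: (delta_mx i j : 'M[R]_(m, n))).
  do 2!(apply: Ck_on_sum => // ? _); apply: Ck_onZ => //; exact: Ck_on_cst.
by apply: Ck_on_ext => // x _; rewrite -matrix_sum_delta.
Qed.

Lemma Ck_on_mulmx E k (U : set E) m n p
    (A : E -> 'M[R]_(m, n)) (B : E -> 'M[R]_(n, p)) :
  open U -> Ck_on k U A -> Ck_on k U B -> Ck_on k U (fun x => A x *m B x).
Proof. exact: (@Ck_on_bilin _ E _ _ _ k U (@mulmx R m n p)). Qed.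

Lemma Ck_on_trmx E k (U : set E) m n (A : E -> 'M[R]_(m, n)) :
  open U -> Ck_on k U A -> Ck_on k U (fun x => (A x)^T).
Proof. by apply: Ck_on_comp_lin => a B C; rewrite linearP. Qed.

Lemma Ck_on_det E k (U : set E) n (A : E -> 'M[R]_n) :
  open U -> Ck_on k U A -> Ck_on k U (fun x => \det (A x) : R^o).
Proof.
move=> oU /Ck_on_mxP CA; apply: Ck_on_sum => // s _; apply: Ck_onM => //.
  exact: Ck_on_cst.
by apply: Ck_on_prod => // i _; exact: CA.
Qed.

(** By Cramer's rule the inverse is the adjugate over the determinant, and both are polynomial in
    the entries. *)
Lemma Ck_on_invmx E k (U : set E) n (A : E -> 'M[R]_n) :
  open U -> (forall x, U x -> A x \in unitmx) -> Ck_on k U A ->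
  Ck_on k U (fun x => invmx (A x)).
Proof.
move=> oU uA CA.
suff : Ck_on k U (fun x => ((\det (A x))^-1 : R^o) *: \adj (A x)).
  by apply: Ck_on_ext => // x Ux; rewrite /invmx uA.
apply: Ck_onZ => //.
  apply: Ck_onV => //; last exact: Ck_on_det.
  by move=> x Ux; rewrite -unitfE -unitmxE uA.
apply/Ck_on_mxP => // i j.
suff : Ck_on k U (fun x => (-1) ^+ (j + i) * \det (row' j (col' i (A x))) : R^o).
  by apply: Ck_on_ext => // x _; rewrite mxE.
apply: Ck_onM => //; first exact: Ck_on_cst.
apply: Ck_on_det => //; apply/Ck_on_mxP => // i' j'.
move/Ck_on_mxP : CA => /(_ oU (lift j i') (lift i j')).
by apply: Ck_on_ext => // x _; rewrite !mxE.
Qed.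

(** As a matrix, the differential is itself a C^k map of the base point, and can be multiplied by
    vectors that move with it. *)
Definition jac n c (f : 'cV[R]_n -> 'cV[R]_c) x : 'M[R]_(c, n) :=
  \matrix_(i, j) 'd f x (delta_mx j 0) i 0.

Lemma jacE n c (f : 'cV[R]_n -> 'cV[R]_c) x v : 'd f x v = jac f x *m v.
Proof.
apply/colP => i; rewrite [in LHS](matrix_sum_delta v) linear_sum !mxE summxE.
apply: eq_bigr => j _; rewrite big_ord1 linearZ/= !mxE mulrC.
by [].
Qed.

Lemma Ck_on_jac n c k (U : set 'cV[R]_n) (f : 'cV[R]_n -> 'cV[R]_c) :
  open U -> Ck_on k.+1 U f -> Ck_on k U (jac f).
Proof.
move=> oU Cf; apply/Ck_on_mxP => // i j.
have /Ck_on_mxP := @Ck_on_diff _ _ _ _ _ _ (delta_mx j 0) Cf.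
move=> /(_ oU i 0); apply: Ck_on_ext => // x _; rewrite mxE//.
Qed.

End MatrixCalculus.

(** * Strict differentiability, and contractions of a closed ball *)

HB.instance Definition _ (R : realType) (m n : nat) :=
  Uniform_isComplete.Build 'M[R]_(m, n) (@mx_complete R m n).

Section StrictDifferentiability.
Variable R : realType.
Implicit Types E F G : finNormedModType R.

(** [Ck_on] gives continuity of the differential along fixed vectors; applied to a finite basis it
    gives continuity in operator norm. The bounds [C i] on the coordinates add up to the factor
    [S]. *)
Lemma diff_norm_near E F (U : set E) (f : E -> F) x e :
  open U -> U x -> Ck_on 1 U f -> 0 < e ->
  \forall y \near x, forall w, `|'d f y w - 'd f x w| <= e * `|w|.
Proof.
move=> oU Ux Cf e0.
pose N := \dim {:E}.
pose b (i : 'I_N) : E := (vbasis {:E})`_i.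
have /choice[C HC] (i : 'I_N) :
    exists C : R, 0 < C /\ forall w, `|coord (vbasis {:E}) i w : R^o| <= C * `|w|.
  have [C C0 HC] := @linear_bounded _ E R^o (coord (vbasis {:E}) i).
  by exists C.
pose S := 1 + \sum_i C i.
have S0 : 0 < S by rewrite ltr_pwDl// sumr_ge0// => i _; exact/ltW/(HC i).1.
have : \forall y \near x, forall i, `|'d f y (b i) - 'd f x (b i)| <= e / S.
  apply: filter_forall => i.
  have /(_ x Ux)/cvgrPdist_le/(_ (e / S)) := Ck_on_diff (b i) Cf.
  rewrite divr_gt0// => /(_ isT); apply: filterS => y.
  by rewrite distrC.
apply: filterS => y Hy w.
have dE z : 'd f z w = \sum_i coord (vbasis {:E}) i w *: 'd f z (b i).
  rewrite [in LHS](coord_vbasis (memvf w)) linear_sum.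
  by apply: eq_bigr => i _; rewrite linearZ.
rewrite !dE -sumrB.
apply: le_trans (ler_norm_sum _ _ _) _.
apply: (@le_trans _ _ (\sum_i (C i * `|w|) * (e / S))).
  apply: ler_sum => i _; rewrite -scalerBr normrZ.
  by rewrite ler_pM//; exact: (HC i).2.
rewrite -mulr_suml -mulr_suml mulrC mulrA ler_wpM2r//.
by rewrite mulrAC ler_pdivrMr// ler_pM2l// lerDr.
Qed.

(** The mean value theorem on the segment from [z] to [y], applied to [f] minus its linear part at
    [x]. It holds for scalar functions only, but for the maximum norm it is enough to treat one
    entry at a time. *)
Lemma strictly_differentiable E c (U : set E) (f : E -> 'cV[R]_c) x e :
  open U -> U x -> Ck_on 1 U f -> 0 < e ->
  exists2 d, 0 < d & forall y z, ball x d y -> ball x d z ->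
    `|f y - f z - 'd f x (y - z)| <= e * `|y - z|.
Proof.
move=> oU Ux Cf e0.
have nU : \forall y \near x, U y by exact: open_nbhs_nbhs.
have /nbhs_ballP[d d0 Hd] : \forall y \near x,
    U y /\ forall w, `|'d f y w - 'd f x w| <= e * `|w|.
  by apply: filterI => //; exact: diff_norm_near Cf e0.
exists d => // y z xy xz; apply: mx_norm_le => [|i j]; first by rewrite mulr_ge0// ltW.
rewrite {}(ord1 j).
pose p (t : R^o) := t *: (y - z) + z.
have xp t : 0 <= t <= 1 -> ball x d (p t).
  move=> /andP[t0 t1]; move: xy xz; rewrite -!ball_normE/= => xy xz.
  have -> : x - p t = t *: (x - y) + (1 - t) *: (x - z).
    rewrite scalerBl scale1r addrCA -scalerBr opprB [x - y + _]addrC addrA subrK.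
    by rewrite /p opprD addrCA addrC -scalerN opprB.
  rewrite (le_lt_trans (ler_normD _ _))// !normrZ !ger0_norm ?subr_ge0//.
  have [->|t0'] := eqVneq t 0; first by rewrite mul0r add0r subr0 mul1r.
  rewrite (@lt_le_trans _ _ (t * d + (1 - t) * d))//.
    apply: ltr_leD; first by rewrite ltr_pM2l// lt_def t0'.
    by rewrite ler_wpM2l ?subr_ge0// ltW.
  by rewrite -mulrDl addrC subrK mul1r.
pose L (w : 'cV[R]_c) : R^o := w i 0.
have lL : linear L by move=> a u v; rewrite /L !mxE.
pose LM := GRing.isLinear.Build _ _ _ _ L lL.
pose L' : {linear 'cV[R]_c -> R^o} := HB.pack L LM.
pose q (t : R) : R := f (p t) i 0 - t * 'd f x (y - z) i 0.
pose dq (t : R) : R := 'd f (p t) (y - z) i 0 - 'd f x (y - z) i 0.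
have qd (t : R) : 0 <= t <= 1 ->
    is_diff (t : R^o) (q : R^o -> R^o) (fun u : R^o => u * dq t : R^o).
  move=> t01.
  have Up := (Hd _ (xp t t01)).1.
  have pd : is_diff (t : R^o) p (fun u => u *: (y - z)) by exact: is_diff_line.
  have := @is_diff_comp_linear _ _ _ _ L' _ _ _
    (is_diff_comp pd (Ck_on_is_diff Cf Up)).
  move=> [Lp LpE].
  have -> : (fun u => u * dq t) =
      'd (L' \o (f \o p)) t \- (fun u : R^o => u *: L ('d f x (y - z))).
    rewrite LpE; apply/funext => u; rewrite /= linearZ /L mxE.
    exact: mulrBr.
  rewrite (_ : q =
    (L' \o (f \o p)) \- (fun u : R^o => u *: L ('d f x (y - z))))//.
  apply: is_diffB; first exact: differentiableP.
have [t /[!in_itv]/= t01] :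
    exists2 t, t \in `[0, 1]%R & q 1 - q 0 = dq t * (1 - 0).
  apply: MVT_segment => //.
    move=> t /[!in_itv]/= /andP[/ltW t0 /ltW t1].
    have [//|qt qtE] := qd t; first by rewrite t0.
    split; first exact: diff_derivable.
    by rewrite deriveE// qtE mul1r.
  apply: continuous_in_subspaceT => t /[!inE]/= /[!in_itv]/= /qd[qt _].
  exact: differentiable_continuous.
rewrite subr0 mulr1 /q /p !scale1r !scale0r subrK add0r mul1r mul0r subr0.
rewrite addrAC => qE.
rewrite !mxE qE.
rewrite /dq; have := (Hd _ (xp t t01)).2 (y - z).
apply: le_trans; rewrite (le_trans _ (mx_coord_le _ i 0))//.
by rewrite !mxE.
Qed.

Lemma contraction_fixed_point c (r : R) (f : 'cV[R]_c -> 'cV[R]_c) : 0 <= r ->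
  (forall s, `|s| <= r -> `|f s| <= r) ->
  (forall s s', `|s| <= r -> `|s'| <= r -> `|f s - f s'| <= 2^-1 * `|s - s'|) ->
  exists2 s, `|s| <= r & f s = s.
Proof.
move=> r0 fr fL.
pose U := [set s : 'cV[R]_c | `|s| <= r].
have fU : set_fun U U f by move=> s; exact: fr.
pose fM := isFun.Build _ _ U U f fU.
pose g : {fun U >-> U} := HB.pack f fM.
have cg : is_contraction g.
  exists 2^-1%:nng; split => /=; first by rewrite invf_lt1// ltr1n.
  by move=> [s s'] [/= Us Us']; exact: fL.
have cU : closed U.
  rewrite (_ : U = (@Num.norm _ _) @^-1` [set x : R | x <= r])//.
  by apply: closed_comp => [u _|]; [exact: norm_continuous | exact: closed_le].
have [|s Us sE] := banach_fixed_point cg cU; first by exists 0; rewrite /U/= normr0.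
by exists s.
Qed.
End StrictDifferentiability.

(** * Curves with prescribed velocity in a zero set *)

Section ImplicitCurve.
Variables (R : realType) (n c : nat).
Implicit Types (U : set 'cV[R]_n) (h : 'cV[R]_n -> 'cV[R]_c).

(* A local right inverse [W] of the differential splits the space; the curve is
   x + t v + W s(t), s(t) being the fixed point of s |-> s - h (x + t v + W s). *)
Lemma implicit_curve U h x v (W : 'M[R]_(n, c)) :
  open U -> U x -> Ck_on 1 U h -> h x = 0 -> 'd h x v = 0 ->
  jac h x *m W = 1%:M ->
  exists e L (s : R -> 'cV[R]_c),
  [/\ 0 < e, s 0 = 0,
    (forall t, `|t| < e -> U (x + (t *: v + W *m s t))),
    (forall t, `|t| < e -> h (x + (t *: v + W *m s t)) = 0) &
    forall t t', `|t| < e -> `|t'| < e -> `|s t - s t'| <= L * `|t - t'|].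
Proof.
move=> oU Ux Ch hx0 Av AW.
have [K K0 HK] := mx_linear_bounded (@mulmx R n c 1 W).
(* With [e * K = 1/2], strict differentiability with constant [e] makes the map of [s] a contraction
   of ratio 1/2. *)
pose e := (2 * K)^-1.
have e0 : 0 < e by rewrite invr_gt0 mulr_gt0.
have eK : e * K = 2^-1 by rewrite /e invfM mulfVK// gt_eqF.
have [d1 d10 Hd1] := strictly_differentiable oU Ux Ch e0.
have /nbhs_ballP[d2 d20 Hd2] : nbhs x U by exact: open_nbhs_nbhs.
pose d := Num.min d1 d2.
have d0 : 0 < d by rewrite lt_min d10 d20.
have Hd y z : `|y - x| < d -> `|z - x| < d ->
    `|h y - h z - 'd h x (y - z)| <= e * `|y - z|.
  rewrite !lt_min => /andP[y1 _] /andP[z1 _].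
  by apply: Hd1; rewrite -ball_normE/= distrC.
have dU y : `|y - x| < d -> U y.
  by rewrite lt_min => /andP[_ y2]; apply: Hd2; rewrite -ball_normE/= distrC.
(* The distance [d] to [x] is shared: [W *m s] uses at most half of it when [|s| <= r], and [t *: v]
   less than half when [|t| < T]. *)
pose r := d / 2 / (2 * K).
have r0 : 0 < r by rewrite !divr_gt0// mulr_gt0.
have Kr : K * r <= d / 2.
  have -> : K * r = d / 4 by rewrite /r; field; rewrite gt_eqF.
  lra.
(* The second bound makes [|h (p t 0)| <= r / 2]; as contraction contributes another [r / 2], the
   ball of radius [r] is mapped to itself. Adding 1 covers [v = 0]. *)
pose T := Num.min (d / 2) (r / 2 / e) / (1 + `|v|).
have v1 : 0 < 1 + `|v| by rewrite ltr_pwDl.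
have T0 : 0 < T.
  apply: divr_gt0 => //; rewrite lt_min divr_gt0//=.
  by apply: divr_gt0 => //; apply: divr_gt0.
have tv (t : R) : `|t| < T -> `|t| * `|v| < d / 2 /\ e * (`|t| * `|v|) <= r / 2.
  rewrite ltr_pdivlMr// mulrDr mulr1 lt_min => /andP[t1 t2].
  have t0 := normr_ge0 t; split.
    by rewrite (le_lt_trans _ t1)// lerDr.
  by rewrite mulrC -ler_pdivlMr// (le_trans _ (ltW t2))// lerDr.
pose p t s := x + (t *: v + W *m s).
have pB t s t' s' : p t s - p t' s' = (t - t') *: v + W *m (s - s').
  by rewrite /p opprD addrACA subrr add0r opprD addrACA scalerBl mulmxBr.
have dp t s t' s' : 'd h x (p t s - p t' s') = s - s'.
  by rewrite pB linearD linearZ/= Av scaler0 add0r jacE mulmxA AW mul1mx.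
have pd t s : `|t| < T -> `|s| <= r -> `|p t s - x| < d.
  move=> /tv[tT _] sr; have -> : x = p 0 0 by rewrite /p scale0r mulmx0 !addr0.
  rewrite pB !subr0 (le_lt_trans (ler_normD _ _))// normrZ.
  rewrite [ltRHS]splitr ltr_leD// (le_trans (HK _))//.
  by rewrite (le_trans (ler_wpM2l (ltW K0) sr)).
have r00 : `|0 : 'cV[R]_c| <= r by rewrite normr0 ltW.
have T00 : `|0 : R| < T by rewrite normr0.
have Hs t s s' : `|t| < T -> `|s| <= r -> `|s'| <= r ->
    `|h (p t s) - h (p t s') - (s - s')| <= 2^-1 * `|s - s'|.
  move=> tT sr sr'; rewrite -[X in _ - X](dp t s t s').
  rewrite (le_trans (Hd _ _ (pd _ _ tT sr) (pd _ _ tT sr')))//.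
  rewrite pB subrr scale0r add0r -eK -mulrA ler_pM2l//.
  exact: HK.
have /choice[s sP] t : exists s, `|t| < T -> `|s| <= r /\ h (p t s) = 0.
  have [tT|] := boolP (`|t| < T); last by exists 0.
  have [||s sr fs] :=
    @contraction_fixed_point R c r (fun s => s - h (p t s)) (ltW r0).
  - move=> s sr.
    have := Hs t s 0 tT sr r00; rewrite subr0 => H1.
    have H2 : `|h (p t 0)| <= r / 2.
      have := Hd _ _ (pd t 0 tT r00) (pd 0 0 T00 r00).
      rewrite dp subrr subr0 {2}/p scale0r mulmx0 !addr0 hx0 subr0.
      rewrite pB !subr0 mulmx0 addr0.
      rewrite normrZ => H2; apply: (le_trans H2).
      by have [_] := tv t tT.
    rewrite (_ : s - _ = - (h (p t s) - h (p t 0) - s) - h (p t 0)); last first.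
      by apply/matrixP => i j; rewrite !mxE; ring.
    rewrite (le_trans (ler_normB _ _))// normrN [leRHS]splitr lerD//.
    by rewrite (le_trans H1)// mulrC ler_wpM2r// invr_ge0.
  - move=> s1 s2 sr1 sr2; have := Hs t s1 s2 tT sr1 sr2.
    rewrite -normrN; congr (`|_| <= _).
    by apply/matrixP => i j; rewrite !mxE; ring.
  - exists s => _; split=> //.
    by move/eqP : fs; rewrite -subr_eq0 addrAC subrr add0r oppr_eq0 => /eqP.
exists T, (2 * e * `|v|), s; split=> //.
- have [s0r hs0] := sP 0 T00.
  have := Hs 0 (s 0) 0 T00 s0r r00.
  rewrite hs0 {1}/p scale0r mulmx0 !addr0 hx0 !subr0 add0r normrN.
  by move=> s0; apply/normr0_eq0/le_anti/andP; split=> //; lra.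
- by move=> t tT; apply/dU/pd => //; exact: (sP t tT).1.
- by move=> t tT; exact: (sP t tT).2.
move=> t t' tT tT'.
have [st ht] := sP t tT; have [st' ht'] := sP t' tT'.
(* Both points are zeros of [h], so the estimate bounds the linear part [s t - s t'] alone. Half of
   [|s t - s t'|] is absorbed on the left, whence the constant [2 * e * |v|]. *)
have := Hd _ _ (pd _ _ tT st) (pd _ _ tT' st').
rewrite dp ht ht' subrr add0r normrN pB => H.
have : `|s t - s t'| <= e * (`|t - t'| * `|v|) + 2^-1 * `|s t - s t'|.
  rewrite (le_trans H)// -eK -mulrA -mulrDr ler_pM2l// (le_trans (ler_normD _ _))//.
  by rewrite normrZ lerD2l HK.
lra.
Qed.

Lemma open_unitmx (E : finNormedModType R) m (U : set E) (A : E -> 'M[R]_m) :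
  open U -> Ck_on 0 U A -> open (U `&` [set x | A x \in unitmx]).
Proof.
move=> oU CA; have Cdet := Ck_on_det oU CA.
rewrite openE => x [Ux]; rewrite /= unitmxE unitfE => dx.
apply: filterI; first exact: open_nbhs_nbhs.
have : \forall y \near x, \det (A y) != 0 :> R^o.
  by apply: cvgr_neq0 dx; exact: Cdet.
by apply: filterS => y; rewrite /= unitmxE unitfE.
Qed.

(** [W] inverts the differential at [x] only, but [jac h y *m W] stays invertible near [x]. There
    the derivative of [s] is determined by the position on the curve. *)
Lemma diff_ker_tangent U h (M : set 'cV[R]_n) x v (W : 'M[R]_(n, c)) :
  open U -> U x -> smooth_on U h -> h x = 0 -> 'd h x v = 0 ->
  jac h x *m W = 1%:M -> (forall y, U y -> h y = 0 -> M y) ->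
  tangent_space M x v.
Proof.
move=> oU0 U0x Ch hx0 Av AW hM.
pose A y := jac h y *m W.
have CA k : Ck_on k U A.
  by apply: Ck_on_mulmx => //; [exact: Ck_on_jac | exact: Ck_on_cst].
pose V := U `&` [set y | A y \in unitmx].
have oV : open V by exact: open_unitmx.
have VU : V `<=` U by move=> y [].
have Vx : V x by split=> //=; rewrite /A AW unitmx1.
have [e [L [s [e0 s0 sV sh sL]]]] :=
  implicit_curve oV Vx (Ck_on_sub VU (Ch 1)) hx0 Av AW.
pose B := ball (0 : R^o) e.
have oB : open B by exact: ball_open.
have BP t : B t -> `|t| < e by rewrite /B -ball_normE/= sub0r normrN.
pose p (t : R^o) := x + (t *: v + W *m s t).
(* Solves for [s'] the relation [jac h (p t) *m (v + W *m s') = 0], the formal derivative of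
   [h (p t) = 0]. *)
pose G y := - (invmx (A y) *m (jac h y *m v)).
have [K K0 HK] := mx_linear_bounded (@mulmx R n c 1 W).
have pB t t' : p t - p t' = (t - t') *: v + W *m (s t - s t').
  by rewrite /p opprD addrACA subrr add0r opprD addrACA scalerBl mulmxBr.
(* A Lipschitz constant for [p]; the absolute value and the 1 make it positive whatever the sign of
   [L]. *)
pose L' := `|v| + K * `|L| + 1.
have L'0 : 0 < L' by rewrite ltr_pwDr// addr_ge0// mulr_ge0// ltW.
have pL t t' : B t -> B t' -> `|p t - p t'| <= L' * `|t - t'|.
  move=> Bt Bt'; rewrite pB (le_trans (ler_normD _ _))// normrZ.
  have H1 := HK (s t - s t').
  have H2 : K * `|s t - s t'| <= K * (`|L| * `|t - t'|).
    rewrite ler_pM2l// (le_trans (sL _ _ (BP _ Bt) (BP _ Bt')))//.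
    by rewrite ler_wpM2r// ler_norm.
  rewrite (le_trans (lerD (lexx _) (le_trans H1 H2)))// /L' !mulrDl mul1r.
  by rewrite mulrC mulrA lerDl.
have sdiff (t : R^o) : B t ->
    is_diff t (s : R^o -> _) (fun u : R^o => u *: G (p t)).
  move=> Bt.
  have [Vpt upt] := sV t (BP t Bt); rewrite -/(p t) in Vpt upt.
  have lL : linear (fun u : R^o => u *: G (p t)).
    by move=> a u w; rewrite scalerDl scalerA.
  pose LM := GRing.isLinear.Build _ _ _ _ _ lL.
  pose lG : {linear R^o -> 'cV[R]_c} :=
    HB.pack (fun u : R^o => u *: G (p t)) LM.
  apply/(@is_diffP _ _ _ _ lG) => eta eta0.
  pose N := invmx (A (p t)).
  have [C C0 HC] := mx_linear_bounded (@mulmx R c c 1 N).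
  have /is_diffP/(_ (eta / (C * L'))) := Ck_on_is_diff (Ch 1) Vpt.
  rewrite divr_gt0 ?mulr_gt0// => /(_ isT)/nbhs_norm0P[d /= d0 Hd].
  have nB : \forall u \near t, B u by exact: open_nbhs_nbhs.
  rewrite (near_shift 0) subr0 /= in nB.
  have nd : \forall u \near (0 : R^o), `|u| < d / L'.
    by apply/nbhs_norm0P; exists (d / L') => //=; rewrite divr_gt0.
  near=> u.
  have But : B (u + t) by near: u.
  pose k := p (u + t) - p t.
  have kL : `|k| <= L' * `|u|.
    by rewrite (le_trans (pL _ _ But Bt))// addrK.
  have kd : `|k| < d.
    by rewrite (le_lt_trans kL)// mulrC -ltr_pdivlMr//; near: u.
  have := Hd k kd.
  rewrite subrK sh ?BP// sh ?BP// subrr sub0r normrN jacE => Hk.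
  (* The error of the candidate derivative is [N] applied to the linear part of the increment of
     [h]. This increment is zero, so the linear part is a remainder, of size [o(|k|)], and
     [|k| <= L' * |u|]. *)
  have -> : s (u + t) - s t - lG u = N *m (jac h (p t) *m k).
    rewrite /k pB addrK mulmxDr mulmxA -/(A _) mulmxDr mulKmx// -scalemxAr -scalemxAr.
    by rewrite /lG/= /G scalerN opprK addrC.
  rewrite (le_trans (HC _))//.
  rewrite (le_trans (ler_wpM2l (ltW C0) Hk))//.
  have -> : eta * `|u| = C * (eta / (C * L') * (L' * `|u|)).
    by field; rewrite !gt_eqF.
  by rewrite ler_pM2l// ler_pM2l// divr_gt0// mulr_gt0.
have pdiff (t : R^o) : B t ->
    is_diff t p (fun u : R^o => u *: (v + W *m G (p t))).
  move=> Bt.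
  have H := is_diffD (is_diff_line x v t)
    (@is_diff_comp_linear _ _ _ _ (@mulmx R n c 1 W) _ _ _ (sdiff t Bt)).
  have pE : p = (fun u : R^o => u *: v + x) + (mulmx W \o s).
    by apply/funext => u; rewrite /p addrA [x + _]addrC.
  rewrite -pE in H; apply: (is_diff_eq H).
  by apply/funext => u /=; rewrite scalerDr scalemxAr.
have CG k : Ck_on k V G.
  have CJ k' := Ck_on_sub VU (Ck_on_jac oU0 (Ch k'.+1)).
  apply: (@Ck_on_comp_lin _ _ _ _ _ _ (fun y => - y)) => //.
    by move=> a y z; rewrite opprD scalerN.
  apply: Ck_on_mulmx => //.
    by apply: Ck_on_invmx => //; [move=> y [] | exact: Ck_on_sub (CA k)].
  by apply: Ck_on_mulmx => //; exact: Ck_on_cst.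
(* [p] solves the autonomous equation [p' = v + W (G p)]. *)
have Cp k : Ck_on k B p.
  elim: k => [|k IH].
    by move=> t /pdiff[pt _]; exact: differentiable_continuous.
  apply: (Ck_onS oB pdiff) => u.
  apply: (@Ck_on_comp_lin _ _ _ _ _ _ (fun y => u *: y)) => //.
    by move=> a y z; rewrite scalerDr !scalerA mulrC.
  apply: Ck_onD => //; first exact: Ck_on_cst.
  apply: Ck_on_mulmx => //; first exact: Ck_on_cst.
  apply: (Ck_on_comp oB oV) (CG k) IH => t Bt; exact: sV (BP _ Bt).
have B0 : B 0 by exact: ballxx.
have p0 : p 0 = x by rewrite /p scale0r s0 mulmx0 !addr0.
exists e, p; split=> //.
- move=> t Bt; apply: hM; last exact: sh (BP _ Bt).
  by apply: VU; exact: sV (BP _ Bt).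
- have [dp dpE] := pdiff 0 B0.
  apply: (etrans (derive1E' dp)); apply: (etrans (congr1 (@^~ 1) dpE)).
  by rewrite scale1r p0 /G -jacE Av mulmx0 oppr0 mulmx0 addr0.
Unshelve. all: by end_near. Qed.

End ImplicitCurve.

(** * Tangent spaces as kernels; zero sets of submersions; symmetric matrices *)

Section Submersions.
Variable R : realType.

Lemma tangent_diff_ker (E F : finNormedModType R) (U : set E) (h : E -> F)
    (M : set E) x v :
  open U -> U x -> Ck_on 1 U h -> (forall y, U y -> M y -> h y = 0) ->
  tangent_space M x v -> 'd h x v = 0.
Proof.
move=> oU Ux Ch hM [e [c [e0 Cc Mc c0 cv]]].
have B0 : ball (0 : R^o) e 0 by exact: ballxx.
have oB : open (ball (0 : R^o) e) by exact: ball_open.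
have dc := Ck_on_is_diff (Cc 1) B0.
rewrite -c0 in Ux *.
have dhc := is_diff_comp dc (Ck_on_is_diff Ch Ux).
have dhc0 : is_diff (0 : R^o) (cst 0 : R^o -> F) ('d h (c 0) \o 'd c 0).
  apply: is_diff_near dhc.
  near=> t; apply: hM; last by apply: Mc; near: t; exact: open_nbhs_nbhs.
  near: t; apply: (differentiable_continuous (@ex_diff _ _ _ _ _ _ _ dc)).
  exact: open_nbhs_nbhs.
have : 'd (cst 0 : R^o -> F) (0 : R^o) = (fun=> 0) :> (R^o -> F).
  exact: diff_cst.
case: dhc0 => _ -> /(congr1 (@^~ 1)) /=.
suff -> : 'd c (0 : R^o) 1 = v by [].
by rewrite -cv; apply/esym/derive1E'; case: dc.
Unshelve. all: by end_near. Qed.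

(** The diagonal entries of [A *m A^T] are sums of squares of the rows. *)
Lemma mulmx_trmx_eq0 m n (A : 'M[R]_(m, n)) : A *m A^T = 0 -> A = 0.
Proof.
move=> AA; apply/matrixP => i j; rewrite mxE.
have : \sum_k A i k ^+ 2 = 0.
  have /matrixP/(_ i i) := AA; rewrite !mxE => {2}<-.
  by apply: eq_bigr => k _; rewrite mxE expr2.
move/psumr_eq0P => /(_ _ j isT)/eqP; rewrite sqrf_eq0 => H; apply/eqP/H => k _.
exact: sqr_ge0.
Qed.

(** [W] is the Moore-Penrose inverse [J^T (J J^T)^-1], whose columns are orthogonal to the kernel of
    [J]. The Gram matrix [J J^T] is invertible: if [K J J^T = 0] then [K J] has zero Gram matrix, so
    [K J = 0], and [K = 0] because [J] has a right inverse. *)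
Lemma right_inverse m n (J : 'M[R]_(m, n)) :
  (forall a : 'cV_m, exists v, J *m v = a) ->
  exists2 W, J *m W = 1%:M &
    forall p (P : 'M_(n, p)), J *m P = 0 -> W^T *m P = 0.
Proof.
move=> sJ.
have [v vJ] := choice sJ.
have JV : J *m (\matrix_(i, j) v (delta_mx j 0) i 0) = 1%:M.
  apply/matrixP => i j; have /matrixP/(_ i 0) := vJ (delta_mx j 0).
  rewrite !mxE andbT => <-; by apply: eq_bigr => k _; rewrite mxE.
have uJ : J *m J^T \in unitmx.
  rewrite -row_free_unit -kermx_eq0.
  have : kermx (J *m J^T) *m J = 0.
    apply: mulmx_trmx_eq0.
    by rewrite trmx_mul mulmxA -(mulmxA _ J) mulmx_ker mul0mx.
  move/(congr1 (mulmx^~ (\matrix_(i, j) v (delta_mx j 0) i 0))).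
  by rewrite -mulmxA JV mulmx1 mul0mx => ->.
exists (J^T *m invmx (J *m J^T)); first by rewrite mulmxA mulmxV.
by move=> p P JP; rewrite trmx_mul trmxK -mulmxA JP mulmx0.
Qed.

(** The rank condition is assumed at one point, whereas a defining map of a bundle must describe
    tangent spaces at all nearby points of [M]. Shrinking [U] to where [jac h y *m W] is invertible
    keeps [jac h y] surjective. *)
Lemma local_defining_function n d (M : set 'cV[R]_n) x :
  embedded_submanifold M d -> M x -> exists c U (h : 'cV[R]_n -> 'cV[R]_c),
  [/\ (d + c = n)%N, open U /\ U x, smooth_on U h,
      forall y, U y -> (h y = 0 <-> M y) &
      forall y, U y -> (exists2 W, jac h y *m W = 1%:M &
          forall p (P : 'M_(n, p)), jac h y *m P = 0 -> W^T *m P = 0) /\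
        (M y -> forall v, tangent_space M y v <-> jac h y *m v = 0)].
Proof.
move=> [_ [c dc /[apply]]] [U [h [[oU Ux] Ch hM rh]]].
have [W JW _] : exists2 W, jac h x *m W = 1%:M &
          forall p (P : 'M_(n, p)), jac h x *m P = 0 -> W^T *m P = 0.
  apply: right_inverse => a.
  have : a \in limg (linfun ('d h x)).
    rewrite (_ : limg _ = fullv) ?memvf//; apply/eqP.
    rewrite -dimv_leqif_eq ?subvf// rh dimvf.
    by rewrite /dim/= muln1.
  by case/memv_imgP => v _ ->; exists v; rewrite lfunE/= jacE.
pose A y := jac h y *m W.
have CA : Ck_on 0 U A.
  by apply: Ck_on_mulmx => //; [exact: Ck_on_jac | exact: Ck_on_cst].
exists c, (U `&` [set y | A y \in unitmx]), h; split.
- by rewrite dc /dim/= muln1.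
- by split; [exact: open_unitmx | split=> //=; rewrite /A JW unitmx1].
- by move=> k; apply: Ck_on_sub (Ch k) => y [].
- by move=> y [Uy _]; exact: hM.
move=> y [Uy /= uA].
have [W' JW' W'P] : exists2 W, jac h y *m W = 1%:M &
          forall p (P : 'M_(n, p)), jac h y *m P = 0 -> W^T *m P = 0.
  apply: right_inverse => a; exists (W *m (invmx (A y) *m a)).
  by rewrite !mulmxA mulmxV// mul1mx.
split; first by exists W'.
move=> My v; split=> [tv|Jv].
  rewrite -jacE; apply: (tangent_diff_ker oU Uy (Ch 1)) tv => z Uz.
  by move/(hM z Uz).
apply: (diff_ker_tangent oU Uy Ch _ _ JW').
- by apply/hM.
- by rewrite jacE.
- by move=> z Uz /(hM z Uz).
Qed.

(** The defining maps of the bundles take values in products of matrix spaces; coordinates of [F]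
    turn them into the column-valued maps of the definition. *)
Lemma submersion_embedded (E F : finNormedModType R) (S : set E) d :
  S !=set0 -> (d + dim F = dim E)%N ->
  (forall p, S p -> exists U (h : E -> F),
    [/\ open U /\ U p, smooth_on U h, forall q, U q -> (h q = 0 <-> S q) &
        forall w, exists v, 'd h p v = w]) ->
  embedded_submanifold S d.
Proof.
move=> S0 dF hS; split=> //; exists (dim F) => // p /hS[U [h [[oU Up] Ch h0 sh]]].
have lu : linear (fun y : F => (v2r y)^T) by move=> a y z; rewrite !linearP.
pose uM := GRing.isLinear.Build _ _ _ _ _ lu.
pose u : {linear F -> 'cV[R]_(dim F)} := HB.pack (fun y : F => (v2r y)^T) uM.
have u0 y : u y = 0 -> y = 0.
  move/(congr1 trmx); rewrite trmxK trmx0 => /eqP.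
  by rewrite raddf_eq0; [move/eqP | exact: v2r_inj].
exists U, (u \o h); split=> //.
- by move=> k; apply: Ck_on_comp_linear => //; exact: Ch.
- move=> y Uy; rewrite -(h0 y Uy) /=; split=> [/u0//|->]; by rewrite !linear0.
rewrite (_ : limg _ = fullv); first by rewrite dimvf /dim/= muln1.
apply/eqP; rewrite eqEsubv subvf/=; apply/subvP => w _.
have [v vw] := sh (r2v w^T).
apply/memv_imgP; exists v; first exact: memvf.
have [_ dE] := is_diff_comp_linear u (Ck_on_is_diff (Ch 1) Up).
by rewrite lfunE/= dE/= vw r2vK trmxK.
Qed.

Lemma mx_of_sym_proj k (A : 'M[R]_k) : A^T = A ->
  mx_of_sym (vsproj (sym_vspace R k) A) = A.
Proof. by move=> At; rewrite /mx_of_sym vsprojK// mem_sym_vspace At. Qed.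

Lemma tr_mx_of_sym k (A : symmx R k) : (mx_of_sym A)^T = mx_of_sym A.
Proof. by apply/eqP; rewrite -mem_sym_vspace; exact: subvsP. Qed.

Lemma mx_of_sym_inj k : injective (@mx_of_sym R k).
Proof. exact: subvs_inj. Qed.

(** The entries on and above the diagonal are coordinates; column [j] contributes [j + 1] of
    them. *)
Lemma dim_symmx k : dim (symmx R k) = 'C(k.+1, 2).
Proof.
pose T := {ij : 'I_k * 'I_k | ij.1 <= ij.2}%N.
pose f (A : symmx R k) : {ffun T -> R^o} :=
  [ffun t => mx_of_sym A (val t).1 (val t).2].
have lf : linear f by move=> a A B; apply/ffunP => t; rewrite !ffunE !mxE.
pose fM := GRing.isLinear.Build _ _ _ _ _ lf.
pose L : {linear symmx R k -> {ffun T -> R^o}} := HB.pack f fM.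
have injL : lker (linfun L) == 0%VS.
  apply/lker0P => A B; rewrite !lfunE => AB; apply: mx_of_sym_inj.
  have le (i j : 'I_k) : (i <= j)%N -> mx_of_sym A i j = mx_of_sym B i j.
    by move=> ij; have /ffunP/(_ (exist _ (i, j) ij)) := AB; rewrite !ffunE.
  apply/matrixP => i j; have [|/ltnW] := leqP i j; first exact: le.
  by rewrite -(tr_mx_of_sym A) -(tr_mx_of_sym B) ![_^T i j]mxE => /le.
have surL : limg (linfun L) = fullv.
  apply/eqP; rewrite eqEsubv subvf andTb; apply/subvP => g _.
  (* The default 0 is never read: [A] only uses [G] on pairs in increasing order. *)
  pose G i j : R := if insub (i, j) is Some t then g t else 0.
  pose A := \matrix_(i, j) (if (i <= j)%N then G i j else G j i).
  have At : A^T = A.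
    apply/matrixP => i j; rewrite !mxE; case: ltngtP => // ij.
    by congr (G _ _); apply/val_inj.
  apply/memv_imgP; exists (vsproj (sym_vspace R k) A); first exact: memvf.
  rewrite lfunE; apply/ffunP => t; rewrite ffunE (mx_of_sym_proj At) mxE.
  by rewrite (valP t) /G; case: t => -[i j] ij /=; rewrite insubT.
have := limg_ker_dim (linfun L) fullv.
rewrite (eqP injL) capv0 dimv0 add0n surL !dimvf => <-.
rewrite /dim/= muln1 card_sig.
rewrite -bin2_sum big_mkord.
rewrite (eq_card (B := [pred ij : 'I_k * 'I_k | ij.1 <= ij.2]%N))//.
rewrite -sum1_card.
rewrite -(pair_big_dep predT (fun i j : 'I_k => i <= j)%N (fun _ _ => 1%N))/=.
rewrite (exchange_big_dep predT)//= big_ord_recl add0n.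
apply: eq_bigr => j _.
by rewrite -(big_ord_widen k (fun=> 1%N) (ltn_ord j)) sum1_card card_ord.
Qed.

(** Numerical form of the block decomposition: two symmetric diagonal blocks and one free
    off-diagonal block. *)
Lemma dim_symmx_add k m : (dim (symmx R (k + m)) =
  dim (symmx R k) + dim (symmx R m) + k * m)%N.
Proof.
rewrite !dim_symmx; elim: m => [|m IH]; first by rewrite muln0 !addn0.
by rewrite addnS binS bin1 IH (binS m.+1) bin1 mulnS; lia.
Qed.

End Submersions.

(** * Differentials along a line, product spaces, orthonormal frames *)

Section Preliminaries.
Variable R : realType.
Implicit Types E F G : finNormedModType R.

Lemma is_diff_uniq E F (f df df' : E -> F) x :
  is_diff x f df -> is_diff x f df' -> df = df'.
Proof. by move=> [_ <-] [_ <-]. Qed.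

(** On a line where [f] is a quadratic polynomial, its directional derivative is the linear
    coefficient. This evaluates the differentials of the bundle maps along the fibres without a
    general formula for them. *)
Lemma is_diff_quadratic E F (f df : E -> F) x v w z :
  is_diff x f df ->
  (forall t : R, f (x + t *: v) = f x + t *: w + t ^+ 2 *: z) -> df v = w.
Proof.
move=> fdf ft.
have H1 : is_diff (0 : R^o) (fun t : R^o => f (t *: v + x))
    (fun u : R^o => df (u *: v)).
  by apply: is_diff_comp; [exact: is_diff_line | rewrite scale0r add0r].
have H2 : is_diff (0 : R^o) (fun t : R^o => f (t *: v + x))
    (fun u : R^o => u *: w).
  have lL : linear (fun u : R^o => u *: w) by move=> a u y; rewrite scalerDl scalerA.
  pose LM := GRing.isLinear.Build _ _ _ _ _ lL.
  pose L : {linear R^o -> F} := HB.pack (fun u : R^o => u *: w) LM.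
  apply/(@is_diffP _ _ _ _ L) => e e0; apply/nbhs_norm0P.
  exists (e / (1 + `|z|)) => /= [|h /=]; first by rewrite divr_gt0// ltr_pwDl.
  rewrite ltr_pdivlMr ?ltr_pwDl// mulrDr mulr1 => he.
  rewrite !(addrC _ x) addr0 !ft expr0n/= !scale0r !addr0.
  rewrite -addrA -opprD addrAC subrr add0r normrZ normrX expr2 -mulrA.
  by rewrite mulrC ler_wpM2r// ltW// (le_lt_trans _ he)// lerDr.
have := is_diff_uniq H1 H2 => /(congr1 (@^~ 1)) /=.
by rewrite !scale1r.
Qed.

Lemma Ck_on_fst E F k (U : set (E * F)) : open U -> Ck_on k U (fst : E * F -> E).
Proof. exact: (@Ck_on_linear R _ _ k U fst). Qed.

Lemma Ck_on_snd E F k (U : set (E * F)) : open U -> Ck_on k U (snd : E * F -> F).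
Proof. exact: (@Ck_on_linear R _ _ k U snd). Qed.

Lemma open_fst E F (U : set E) : open U -> open [set p : E * F | U p.1].
Proof. by move=> oU; apply: (open_comp (f := fst)) => // p _; exact: cvg_fst. Qed.

Lemma dim_prod E F : dim (E * F)%type = (dim E + dim F)%N.
Proof. by []. Qed.

Lemma dim_mx m p : dim 'M[R]_(m, p) = (m * p)%N.
Proof. by []. Qed.

(** Gram-Schmidt, one column at a time: as long as [k < d], the [c + k] conditions of being killed
    by [J] and orthogonal to [V] are fewer than [n], so they have a nonzero solution, which is then
    normalized. *)
Lemma orthonormal_kernel n c d k (J : 'M[R]_(c, n)) : 
    (d + c = n)%N -> (k <= d)%N ->
  exists2 V : 'M[R]_(n, k), J *m V = 0 & V^T *m V = 1%:M.
Proof.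
move=> dc; elim: k => [|k IH] kd.
  by exists 0; [exact: mulmx0 | apply/matrixP => -[]].
have [V JV VV] := IH (ltnW kd).
have : kermx (col_mx J V^T)^T != 0.
  rewrite kermx_eq0 /row_free neq_ltn mxrank_tr.
  by rewrite (leq_ltn_trans (rank_leq_row _))//; lia.
set K := kermx _ => K0.
pose u := nz_row K.
have u0 : u != 0 by rewrite nz_row_eq0.
have uK : u *m (col_mx J V^T)^T = 0.
  by apply/sub_kermxP; exact: nz_row_sub.
have : (col_mx J V^T) *m u^T = 0 by rewrite -[LHS]trmxK trmx_mul trmxK uK trmx0.
rewrite mul_col_mx -[0]vsubmxK => /eq_col_mx [Ju Vu].
pose q := (u *m u^T) 0 0.
have q0 : 0 < q.
  rewrite lt_def; apply/andP; split.
    apply: contra_neq u0 => q0; apply: mulmx_trmx_eq0.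
    by rewrite [LHS]mx11_scalar -/q q0 raddf0.
  by rewrite /q mxE sumr_ge0// => i _; rewrite mxE -expr2 sqr_ge0.
pose w := (Num.sqrt q)^-1 *: u^T.
have ww : w^T *m w = 1%:M.
  rewrite [w^T]linearZ/= trmxK -scalemxAl -scalemxAr scalerA -invfM -expr2.
  by rewrite sqr_sqrtr ?ltW// [u *m _]mx11_scalar -/q scale_scalar_mx mulVf ?gt_eqF.
have Vw : V^T *m w = 0 by rewrite -scalemxAr Vu linear0 scaler0.
have Jw : J *m w = 0 by rewrite -scalemxAr Ju linear0 scaler0.
rewrite -addn1; exists (row_mx V w); first by rewrite mul_mx_row JV Jw row_mx0.
rewrite tr_row_mx mul_col_row VV Vw ww -{1}[w^T *m V]trmxK trmx_mul trmxK Vw trmx0.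
by rewrite -scalar_mx_block.
Qed.

End Preliminaries.

(** * The Stiefel bundle *)

Section Stiefel.
Variables (R : realType) (n d k : nat) (M : set 'cV[R]_n).
Hypothesis Md : embedded_submanifold M d.
Hypothesis kd : (k <= d)%N.

Lemma mulmx_col0 c (J : 'M[R]_(c, n)) (V : 'M[R]_(n, k)) :
  (forall j, J *m col j V = 0) <-> J *m V = 0.
Proof.
split=> [H|JV j]; last by rewrite colE mulmxA JV mul0mx.
by apply/matrixP => i j; have /colP/(_ i) := H j; rewrite colE mulmxA -colE !mxE.
Qed.

Lemma stiefel_bundle_submanifold :
  embedded_submanifold (stiefel_bundle k M) (d + k * d - (k * (k + 1)) %/ 2)%N.
Proof.
have [[x0 Mx0] _] := Md.
have [c [U0 [h0 [dc [oU0 Ux0] Ch0 hM0 W0]]]] := local_defining_function Md Mx0.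
apply: (@submersion_embedded R _ ('cV[R]_c * 'M[R]_(c, k) * symmx R k)%type).
- have [V JV VV] := orthonormal_kernel (jac h0 x0) dc kd.
  exists (x0, V); split=> //= j.
  by apply/(W0 _ Ux0).2 => //; move/mulmx_col0 : JV.
- rewrite !dim_prod dim_symmx !dim_mx bin2/= !muln1 -dc addn1 divn2.
  (* Keeps the subtraction of natural numbers in the dimension from truncating. *)
  have : ((k.+1 * k)./2 * 2 <= k * d * 2)%N by rewrite muln2; nia.
  by rewrite (mulnC k k.+1) mulnDl (mulnC d k); lia.
move=> [x V] [/= Mx VV Vt].
have [c' [U [h [dc' [oU Ux] Ch hM HW]]]] := local_defining_function Md Mx.
(* The target was fixed with the codimension found at [x0]; at every point it is [n - d]. *)
have cc' : c' = c by apply/(@addnI d); rewrite dc dc'.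
move: h Ch hM HW; rewrite {}cc' => h Ch hM HW.
have [[W JW WP] /(_ Mx) tx] := HW x Ux.
have JV : jac h x *m V = 0 by apply/mulmx_col0 => j; apply/tx/Vt.
(* [V^T V - 1] is always symmetric, so the map can be onto only if its last component lands in
   symmetric matrices. *)
pose P := vsproj (sym_vspace R k) : {linear 'M[R]_k -> symmx R k}.
pose F (p : 'cV[R]_n * 'M[R]_(n, k)) :=
  ((h p.1, jac h p.1 *m p.2), P (p.2^T *m p.2 - 1%:M)).
pose U' := [set p : 'cV[R]_n * 'M[R]_(n, k) | U p.1].
have oU' : open U' by exact: open_fst.
have CF : smooth_on U' F.
  move=> m; apply: Ck_on_pair => //.
    apply: Ck_on_pair => //.
      by apply: (Ck_on_comp oU' oU) (Ch m) (Ck_on_fst _ oU').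
    apply: Ck_on_mulmx => //; last exact: Ck_on_snd.
    by apply: (Ck_on_comp oU' oU) (Ck_on_jac oU (Ch m.+1)) (Ck_on_fst _ oU').
  apply: Ck_on_comp_linear => //; apply: Ck_onD => //; last exact: Ck_on_cst.
  by apply: Ck_on_mulmx => //; [apply: Ck_on_trmx => //|]; exact: Ck_on_snd.
exists U', F; split=> //.
- move=> [y Z] /= Uy; have ty := (HW y Uy).2.
  split.
    case=> /(hM y Uy) My JZ PZ; split=> //=.
      have := congr1 (@mx_of_sym R k) PZ; rewrite mx_of_sym_proj => [/eqP|].
        by rewrite subr_eq0 => /eqP.
      by rewrite linearB/= trmx_mul trmxK trmx1.
    by move=> j; apply/(ty My); move/mulmx_col0 : JZ.
  move=> [/= My ZZ tZ]; rewrite /F/= ZZ subrr linear0.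
  rewrite ((hM y Uy).2 My).
  by have -> : jac h y *m Z = 0 by apply/mulmx_col0 => j; apply/(ty My)/tZ.
move=> [[a B] S].
suff: forall D : {linear ('cV[R]_n * 'M[R]_(n, k))%type ->
    ('cV[R]_c * 'M[R]_(c, k) * symmx R k)%type},
    is_diff ((x, V) : ('cV[R]_n * 'M[R]_(n, k))%type) F D ->
    exists v, D v = ((a, B), S).
  by apply; exact: Ck_on_is_diff (CF 1) (Ux : U' (x, V)).
move=> D dF.
(* The other components of [D (v, 0)] involve second derivatives of [h]; they are
   compensated by moving along the fibre, where [F] is quadratic. *)
have D1 v : (D (v, 0)).1.1 = jac h x *m v.
  have H1 := @is_diff_comp_linear _ _ _ _ (fst \o fst) _ _ _ dF.
  pose pr1 : {linear ('cV[R]_n * 'M[R]_(n, k))%type -> 'cV[R]_n} := fst.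
  have H2 := is_diff_comp (@is_diff_linear _ _ _ pr1 (x, V))
    (Ck_on_is_diff (Ch 1) Ux).
  have /(congr1 (@^~ (v, 0)))/= := is_diff_uniq H1 H2.
  by rewrite jacE.
pose D0 := D (W *m a, 0).
pose T0 := mx_of_sym (S - D0.2).
have T0T : T0^T = T0 by exact: tr_mx_of_sym.
(* The differential of [V^T V] along [Z] is [V^T Z + Z^T V], which [V^T Z = T] turns into
   [2 T = T0]. In [Z] the term in [W] corrects the second component and is invisible to the third
   since [V^T W = 0]; the term [V T] does the opposite since [J V = 0]. *)
pose T := 2^-1 *: T0.
have TT : T^T = T by rewrite /T linearZ/= T0T.
pose Z := W *m (B - D0.1.2) + V *m T.
have JZ : jac h x *m Z = B - D0.1.2.
  by rewrite mulmxDr !mulmxA JW mul1mx JV mul0mx addr0.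
have VZ : V^T *m Z = T.
  rewrite mulmxDr !mulmxA VV mul1mx.
  rewrite (_ : V^T *m W = 0) ?mul0mx ?add0r//.
  by rewrite -[LHS]trmxK trmx_mul trmxK WP// trmx0.
have ZV : Z^T *m V = T by rewrite -[LHS]trmxK trmx_mul trmxK VZ.
have D2 : D (0, Z) = ((0, B - D0.1.2), S - D0.2).
  apply: (is_diff_quadratic (z := ((0, 0), P (Z^T *m Z))) dF) => t.
  have -> : S - D0.2 = P T0 by rewrite /P/= /T0 /mx_of_sym vsvalK.
  rewrite [RHS](_ : _ = ((h x + t *: 0 + t ^+ 2 *: 0,
    jac h x *m V + t *: (B - D0.1.2) + t ^+ 2 *: 0),
    P (V^T *m V - 1%:M) + t *: P T0 + t ^+ 2 *: P (Z^T *m Z)))//.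
  rewrite /F /= !scaler0 !addr0 mulmxDr -scalemxAr JZ; congr (_, _).
  rewrite -!linearZ -!linearD/=; congr (vsproj _ _).
  rewrite [(V + _)^T]linearD/= [(t *: Z)^T]linearZ/= mulmxDl !mulmxDr.
  rewrite -!scalemxAr -!scalemxAl VZ ZV.
  rewrite /T !scalerA; apply/matrixP => i j; rewrite !mxE.
  by field.
exists (W *m a, Z).
rewrite (_ : (W *m a, Z) = (W *m a, 0) + (0, Z)); last first.
  by congr (_, _); rewrite ?addr0 ?add0r.
have D0a : D0.1.1 = a by rewrite D1 mulmxA JW mul1mx.
rewrite linearD D2 -/D0 [D0]surjective_pairing [D0.1]surjective_pairing D0a.
by congr (_, _, _); rewrite ?addr0// addrC subrK.
Qed.

End Stiefel.

(** * Idempotent matrices close to a given projector *)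

Section Projectors.
Variable R : realType.

(** In a full-rank factorization [P = V Q], the identity [V Q V Q = V Q] can be cancelled by [V] on
    the left and [Q] on the right. *)
Lemma idempotent_factor n k (P : 'M[R]_n) : P *m P = P -> \rank P = k ->
  exists (V : 'M_(n, k)) (Q : 'M_(k, n)), V *m Q = P /\ Q *m V = 1%:M.
Proof.
move=> PP <-; exists (col_base P), (row_base P); split; first exact: mulmx_base.
apply: (row_full_inj (col_base_full P)); apply: (row_free_inj (row_base_free P)).
rewrite /= mulmx1; move: (mulmx_base P); move: (col_base P) (row_base P) => V Q VQ.
by rewrite !mulmxA VQ -mulmxA VQ PP.
Qed.

Lemma idempotent_compl n (P : 'M[R]_n) : P *m P = P ->
  (1%:M - P) *m (1%:M - P) = 1%:M - P.
Proof. by move=> PP; rewrite mulmxBr mulmx1 mulmxBl mul1mx PP subrr subr0. Qed.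

Lemma mul_idempotent_compl n (P : 'M[R]_n) : P *m P = P -> P *m (1%:M - P) = 0.
Proof. by move=> PP; rewrite mulmxBr mulmx1 PP subrr. Qed.

Lemma rank_idempotent_compl n (P : 'M[R]_n) : P *m P = P ->
  \rank (1%:M - P) = (n - \rank P)%N.
Proof.
move=> PP; have kP : (kermx P == 1%:M - P)%MS.
  apply/andP; split; last first.
    by apply/sub_kermxP; rewrite mulmxBl mul1mx PP subrr.
  apply/submxP; exists (kermx P).
  by rewrite mulmxBr mulmx1 mulmx_ker subr0.
by rewrite -(eqmxP kP) mxrank_ker.
Qed.

(** The maximum norm is not submultiplicative; the factor is the number of terms in an entry of the
    product. *)
Lemma mulmx_norm_le m n p (A : 'M[R]_(m, n)) (B : 'M[R]_(n, p)) :
  `|A *m B| <= n%:R * (`|A| * `|B|).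
Proof.
apply: mx_norm_le => [|i j]; first by rewrite !mulr_ge0.
rewrite mxE (le_trans (ler_norm_sum _ _ _))//.
rewrite mulr_natl -[X in _ *+ X]card_ord -sumr_const ler_sum// => l _.
by rewrite normrM ler_pM// mx_coord_le.
Qed.

(** If [K (1 - A) = 0] then [K = K A], whose norm is strictly below that of [K] unless [K = 0]. *)
Lemma unitmx_near1 n (A : 'M[R]_n) : n%:R * `|A| < 1 -> 1%:M - A \in unitmx.
Proof.
move=> A1; rewrite -row_free_unit -kermx_eq0; apply/eqP.
have : kermx (1%:M - A) = kermx (1%:M - A) *m A.
  by apply/eqP; rewrite -subr_eq0 -{1}[kermx _]mulmx1 -mulmxBr mulmx_ker.
set K := kermx _ => KA; apply/normr0_eq0/le_anti; rewrite normr_ge0 andbT.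
have := mulmx_norm_le K A; rewrite -KA mulrCA mulrC => H.
have [->|] := eqVneq K 0; first by rewrite normr0.
rewrite -normr_gt0 => K0.
have : n%:R * `|A| * `|K| < 1 * `|K| by rewrite ltr_pM2r.
lra.
Qed.

(* [P *m P0 + (1 - P) *m (1 - P0)] intertwines [P] and [P0] and tends to [1]
   as [P] tends to [P0]; this is [1] minus it. *)
Definition proj_defect n (P0 P : 'M[R]_n) := P + P0 - 2 *: (P *m P0).

(** The intertwining relation gives equality of ranks. The other one gives [P = P P0 K^-1], so that
    a matrix killing [P V0] kills [P]. *)
Lemma near_projector_intertwine n (P0 P : 'M[R]_n) :
  P0 *m P0 = P0 -> P *m P = P -> 1%:M - proj_defect P0 P \in unitmx ->
  exists2 K, K \in unitmx & P *m K = K *m P0 /\ P *m K = P *m P0.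
Proof.
move=> PP0 PP uK; exists (1%:M - proj_defect P0 P) => //.
have -> : P *m (1%:M - proj_defect P0 P) = P *m P0.
  rewrite mulmxBr mulmx1 mulmxBr mulmxDr -scalemxAr mulmxA PP.
  by apply/matrixP => i j; rewrite !mxE; ring.
split=> //; rewrite mulmxBl mul1mx mulmxBl mulmxDl -scalemxAl -mulmxA PP0.
by apply/matrixP => i j; rewrite !mxE; ring.
Qed.

(** Without diagonal blocks [N] satisfies [P0 N + N P0 = N], while it commutes with [P]. For [P]
    near [P0] these conflict: they give [N = N C + C N] with [C] the defect, hence
    [|N| <= 2 n |C| |N|], and the bound 1/2 forces [N = 0]. *)
Lemma near_projector_idempotent n (P0 P : 'M[R]_n) :
  P0 *m P0 = P0 -> n%:R * `|proj_defect P0 P| < 2^-1 ->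
  P0 *m (P *m P - P) *m P0 = 0 ->
  (1%:M - P0) *m (P *m P - P) *m (1%:M - P0) = 0 -> P *m P = P.
Proof.
move=> PP0 small; set N := P *m P - P => N0 N1.
have PN : P *m N = N *m P by rewrite mulmxBr mulmxBl mulmxA.
suff : N = 0 by move/eqP; rewrite subr_eq0 => /eqP.
move: N => N in N0 N1 PN *.
have anti : P0 *m N + N *m P0 = N.
  move: N1; rewrite mulmxBl mul1mx mulmxBr mulmx1 mulmxBl N0 subr0 => N1.
  by apply/esym/eqP; rewrite -subr_eq0 opprD addrA N1.
pose C := proj_defect P0 P.
(* Here [P *m N = N *m P], whereas [P0 *m N = N *m (1 - P0)]. *)
have NE : N = N *m C + C *m N.
  have P0N : P0 *m N = N - N *m P0 by rewrite -{2}anti addrK.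
  rewrite /C /proj_defect mulmxBr mulmxDr mulmxBl mulmxDl -scalemxAr -scalemxAl.
  rewrite [N *m (P *m P0)]mulmxA -[P *m P0 *m N]mulmxA P0N -PN -mulmxA mulmxBr.
  by apply/matrixP => i j; rewrite !mxE; ring.
apply: normr0_eq0.
apply/le_anti; rewrite normr_ge0 andbT.
have H1 : `|N| <= n%:R * (`|N| * `|C|) + n%:R * (`|C| * `|N|).
  by rewrite {1}NE (le_trans (ler_normD _ _))// lerD// mulmx_norm_le.
have [->|] := eqVneq N 0; first by rewrite normr0.
rewrite -normr_gt0 => K0.
have : n%:R * `|C| * `|N| < 2^-1 * `|N| by rewrite ltr_pM2r.
rewrite -/C in small.
lra.
Qed.

Lemma unitmx_conj_rank n (P P0 K : 'M[R]_n) :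
  K \in unitmx -> P *m K = K *m P0 -> \rank P = \rank P0.
Proof.
move=> uK PK; rewrite -(mxrankMfree P (_ : row_free K)) ?row_free_unit// PK.
by rewrite (eqmxMfull _ _) // row_full_unit.
Qed.

End Projectors.

(** * The Grassmann bundle *)

Section Grassmann.
Variables (R : realType) (n d k : nat) (M : set 'cV[R]_n).
Hypothesis Md : embedded_submanifold M d.
Hypothesis kd : (k <= d)%N.

Lemma mulmx_cV_eq0 m p (A : 'M[R]_(m, p)) : (forall v : 'cV_p, A *m v = 0) -> A = 0.
Proof.
move=> A0; apply/matrixP => i j; have /colP/(_ i) := A0 (delta_mx j 0).
by rewrite -colE !mxE.
Qed.

Lemma grassmann_bundle_nonempty : grassmann_bundle k M !=set0.
Proof.
have [[x Mx] _] := Md.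
have [c [U [h [dc [oU Ux] Ch hM HW]]]] := local_defining_function Md Mx.
have [_ /(_ Mx) tx] := HW x Ux.
have [V JV VV] := orthonormal_kernel (jac h x) dc kd.
have Ps : mx_of_sym (vsproj (sym_vspace R n) (V *m V^T)) = V *m V^T.
  by rewrite mx_of_sym_proj// trmx_mul trmxK.
exists (x, vsproj (sym_vspace R n) (V *m V^T)); split=> //=; rewrite Ps.
- by rewrite mulmxA -(mulmxA V) VV mulmx1.
- apply/eqP; rewrite eqn_leq (leq_trans (mxrankM_maxr _ _) (rank_leq_row _))/=.
  (* The matrix on the left is the identity of size [k]. *)
  have : (\rank (V^T *m (V *m V^T) *m V) <= \rank (V *m V^T))%N.
    by rewrite (leq_trans (mxrankM_maxl _ _))// mxrankM_maxr.
  by rewrite mulmxA VV mul1mx VV mxrank1.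
- by move=> v; apply/tx; rewrite !mulmxA JV !mul0mx.
Qed.

Lemma grassmann_bundle_submanifold :
  embedded_submanifold (grassmann_bundle k M) (d + k * (d - k))%N.
Proof.
have [[x0 Mx0] _] := Md.
have [c [U0 [h0 [dc [oU0 Ux0] Ch0 hM0 W0]]]] := local_defining_function Md Mx0.
pose m := (n - k)%N.
have nkm : n = (k + m)%N by rewrite subnKC// -dc; lia.
apply: (@submersion_embedded R _
  ('cV[R]_c * 'M[R]_(c, k) * (symmx R k * symmx R m))%type).
- exact: grassmann_bundle_nonempty.
(* The two diagonal blocks cancel, leaving [k * m] off-diagonal parameters, of which the tangency
   equations remove [c * k]; since [m = d - k + c], there remain [k * (d - k)]. *)
- have sn : dim (symmx R n) = (dim (symmx R k) + dim (symmx R m) + k * m)%N.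
    by rewrite [in LHS]nkm dim_symmx_add.
  rewrite !dim_prod sn !dim_mx !muln1.
  have dkE : (d = k + (d - k))%N by lia.
  have mE : m = (d - k + c)%N by rewrite /m -dc; lia.
  have dE j : @dim R (symmx R j : finNormedModType R) = dim (symmx R j) by [].
  by rewrite !dE mE -dc mulnDr (mulnC c k); lia.
move=> [x P0s] [/= Mx PP0 rP0 tP0].
have [c' [U [h [dc' [oU Ux] Ch hM HW]]]] := local_defining_function Md Mx.
have cc' : c' = c by apply/(@addnI d); rewrite dc dc'.
move: h Ch hM HW; rewrite {}cc' => h Ch hM HW.
have [[W JW WP] /(_ Mx) tx] := HW x Ux.
set P0 := mx_of_sym P0s in PP0 rP0 tP0.
have P0t : P0^T = P0 by exact: tr_mx_of_sym.
have JP0 : jac h x *m P0 = 0.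
  by apply: mulmx_cV_eq0 => v; rewrite -mulmxA; apply/tx.
have [V0 [R0 [VR0 RV0]]] := idempotent_factor PP0 rP0.
set Q0 := 1%:M - P0.
have QQ0 : Q0 *m Q0 = Q0 := idempotent_compl PP0.
have rQ0 : \rank Q0 = m by rewrite rank_idempotent_compl// rP0.
have [V1 [R1 [VR1 RV1]]] := idempotent_factor QQ0 rQ0.
have PQ0 : P0 *m Q0 = 0 := mul_idempotent_compl PP0.
have Q0t : Q0^T = Q0 by rewrite linearB/= trmx1 P0t.
have P0V0 : P0 *m V0 = V0 by rewrite -VR0 -mulmxA RV0 mulmx1.
have R0P0 : R0 *m P0 = R0 by rewrite -VR0 mulmxA RV0 mul1mx.
have Q0V1 : Q0 *m V1 = V1 by rewrite -VR1 -mulmxA RV1 mulmx1.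
have R1Q0 : R1 *m Q0 = R1 by rewrite -VR1 mulmxA RV1 mul1mx.
have R0V1 : R0 *m V1 = 0 by rewrite -R0P0 -Q0V1 mulmxA -(mulmxA R0) PQ0 mulmx0 mul0mx.
have QP0 : Q0 *m P0 = 0 by rewrite -[LHS]trmxK trmx_mul P0t Q0t PQ0 trmx0.
have R1V0 : R1 *m V0 = 0 by rewrite -R1Q0 -P0V0 mulmxA -(mulmxA R1) QP0 mulmx0 mul0mx.
have R1P0 : R1 *m P0 = 0 by rewrite -VR0 mulmxA R1V0 mul0mx.
(* [P0] and [Q0] are symmetric with product zero, so the two factorizations are orthogonal to each
   other: rows of [R0] and [R1] here, columns of [V0] and [V1] next. *)
have R0R1 : R0 *m R1^T = 0.
  by rewrite -R1Q0 trmx_mul Q0t mulmxA -R0P0 -(mulmxA R0) PQ0 mulmx0 mul0mx.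
have V1V0 : V1^T *m V0 = 0.
  by rewrite -Q0V1 trmx_mul Q0t -P0V0 mulmxA -(mulmxA V1^T) QP0 mulmx0 mul0mx.
have JV0 : jac h x *m V0 = 0 by rewrite -P0V0 mulmxA JP0 mul0mx.
have WV0 : W^T *m V0 = 0 by exact: WP.
have R0W : R0 *m W = 0.
  rewrite -R0P0 -mulmxA (_ : P0 *m W = 0) ?mulmx0// -[LHS]trmxK trmx_mul P0t.
  by rewrite WP// trmx0.
pose p0 := vsproj (sym_vspace R k) : {linear 'M[R]_k -> symmx R k}.
pose p1 := vsproj (sym_vspace R m) : {linear 'M[R]_m -> symmx R m}.
pose N (P : 'M[R]_n) := P *m P - P.
pose F (p : 'cV[R]_n * symmx R n) :=
  ((h p.1, jac h p.1 *m mx_of_sym p.2 *m V0),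
   (p0 (R0 *m N (mx_of_sym p.2) *m R0^T), p1 (R1 *m N (mx_of_sym p.2) *m R1^T))).
pose C (p : 'cV[R]_n * symmx R n) := proj_defect P0 (mx_of_sym p.2).
pose U1 := [set p : 'cV[R]_n * symmx R n | U p.1].
have oU1 : open U1 by exact: open_fst.
have Cs2 j : Ck_on j U1 (fun p : 'cV[R]_n * symmx R n => mx_of_sym p.2).
  apply: (@Ck_on_comp_linear _ _ _ _ j U1
    (vsval : {linear symmx R n -> 'M[R]_n})) => //.
  exact: Ck_on_snd.
have CF j : Ck_on j U1 F.
  have CN : Ck_on j U1 (fun p => N (mx_of_sym p.2)).
    apply: Ck_onD => //; first by apply: Ck_on_mulmx => //; exact: Cs2.
    apply: (@Ck_on_comp_lin _ _ _ _ _ _ (fun y => - y)) => // a y z.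
    by rewrite opprD scalerN.
  have CRN q (Q : 'M[R]_(q, n)) : Ck_on j U1 (fun p => Q *m N (mx_of_sym p.2) *m Q^T).
    apply: Ck_on_mulmx => //; last exact: Ck_on_cst.
    by apply: Ck_on_mulmx => //; exact: Ck_on_cst.
  apply: Ck_on_pair => //; apply: Ck_on_pair => //.
  - by apply: (Ck_on_comp oU1 oU) (Ch j) (Ck_on_fst _ oU1).
  - apply: Ck_on_mulmx => //; last exact: Ck_on_cst.
    apply: Ck_on_mulmx => //.
    by apply: (Ck_on_comp oU1 oU) (Ck_on_jac oU (Ch j.+1)) (Ck_on_fst _ oU1).
  - exact: (@Ck_on_comp_linear _ _ _ _ _ _ p0).
  - exact: (@Ck_on_comp_linear _ _ _ _ _ _ p1).
(* Chosen so that [|C p| < e] gives [n * |C p| < 1/2], the smallness required above; [n.+1] avoids a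
   division by zero. *)
pose e : R := (2 * n.+1%:R)^-1.
pose U' := U1 `&` [set p | `|C p| < e].
have CC : Ck_on 0 U1 C.
  have CP := Cs2 0%N.
  have CP0 : Ck_on 0 U1 (fun=> P0) by exact: Ck_on_cst.
  have lin2 : linear (fun y : 'M[R]_n => - (2 *: y)).
    by move=> b y z; rewrite !scalerDr opprD scalerN !scalerA mulrC.
  have C2 := Ck_on_comp_lin lin2 oU1 (Ck_on_mulmx oU1 CP CP0).
  exact: Ck_onD oU1 (Ck_onD oU1 CP CP0) C2.
have oU' : open U'.
  rewrite openE => p [Up /= Cp]; apply: filterI; first exact: open_nbhs_nbhs.
  have cC : C q @[q --> p] --> C p := CC p Up.
  exact: (cvgr_norm_lt (C p) cC _ Cp).
have C0 : C (x, P0s) = 0.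
  by rewrite /C /proj_defect -/P0 /= PP0 scaler_nat mulr2n subrr.
have U'x : U' (x, P0s) by split=> //=; rewrite C0 normr0 invr_gt0 mulr_gt0.
exists U', F; split=> //.
- by move=> j; apply: Ck_on_sub (CF j) => p [].
- move=> [y Ps] [/= Uy small].
  set P := mx_of_sym Ps.
  have Pt : P^T = P by exact: tr_mx_of_sym.
  have ty := (HW y Uy).2.
  have small' : n%:R * `|proj_defect P0 P| < 2^-1.
    have n1 : n.+1%:R * e = 2^-1 :> R.
      by rewrite /e invfM mulrCA mulfV ?mulr1// pnatr_eq0.
    rewrite -n1; apply: (@le_lt_trans _ _ (n.+1%:R * `|proj_defect P0 P|)).
      by rewrite ler_wpM2r// ler_nat.
    by rewrite ltr_pM2l// ltr0n.
  have uK : 1%:M - proj_defect P0 P \in unitmx.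
    by apply: unitmx_near1; rewrite (lt_trans small')// invf_lt1// ltr1n.
  have symN q (Q : 'M[R]_(q, n)) : (Q *m N P *m Q^T)^T = Q *m N P *m Q^T.
    by rewrite !trmx_mul trmxK linearB/= trmx_mul Pt mulmxA.
  split.
    rewrite /F/= -/P => -[/(hM y Uy) My JPV].
    move=> /(congr1 (@mx_of_sym R k)) N0 /(congr1 (@mx_of_sym R m)) N1.
    rewrite mx_of_sym_proj// in N0; rewrite mx_of_sym_proj// in N1.
    have PP : P *m P = P.
      apply: (near_projector_idempotent PP0 small').
        have -> : P0 *m (P *m P - P) *m P0 = V0 *m (R0 *m N P *m R0^T) *m V0^T.
          by rewrite !mulmxA VR0 -(mulmxA _ R0^T) -trmx_mul VR0 P0t.
        by rewrite N0 mulmx0 mul0mx.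
      have -> : Q0 *m (P *m P - P) *m Q0 = V1 *m (R1 *m N P *m R1^T) *m V1^T.
        by rewrite !mulmxA VR1 -(mulmxA _ R1^T) -trmx_mul VR1 Q0t.
      by rewrite N1 mulmx0 mul0mx.
    have [K Ku [PK PK']] := near_projector_intertwine PP0 PP uK.
    split=> //=; first by rewrite -rP0; exact: unitmx_conj_rank Ku PK.
    move=> v; apply/(ty My); rewrite mulmxA.
    suff -> : jac h y *m P = 0 by rewrite mul0mx.
    rewrite -[P](mulmxK Ku) PK' mulmxA -VR0 !mulmxA JPV !mul0mx//.
  move=> [/= My PP rP tP]; rewrite /F/= -/P /N PP subrr !mulmx0 !mul0mx !linear0.
  rewrite ((hM y Uy).2 My).
  have -> : jac h y *m P = 0.
    by apply: mulmx_cV_eq0 => v; rewrite -mulmxA; apply/(ty My)/tP.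
  by rewrite mul0mx.
move=> [[a B] [S0 S1]].
suff: forall D : {linear ('cV[R]_n * symmx R n)%type ->
    ('cV[R]_c * 'M[R]_(c, k) * (symmx R k * symmx R m))%type},
    is_diff ((x, P0s) : ('cV[R]_n * symmx R n)%type) F D ->
    exists v, D v = ((a, B), (S0, S1)).
  by apply; exact: Ck_on_is_diff (CF 1) (Ux : U1 (x, P0s)).
move=> D dF.
(* The other components of [D (v, 0)] involve second derivatives of [h]; they are
   compensated by moving along the fibre, where [F] is quadratic. *)
have D1 v : (D (v, 0)).1.1 = jac h x *m v.
  have H1 := @is_diff_comp_linear _ _ _ _ (fst \o fst) _ _ _ dF.
  pose pr1 : {linear ('cV[R]_n * symmx R n)%type -> 'cV[R]_n} := fst.
  have H2 := is_diff_comp (@is_diff_linear _ _ _ pr1 (x, P0s))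
    (Ck_on_is_diff (Ch 1) Ux).
  have /(congr1 (@^~ (v, 0)))/= := is_diff_uniq H1 H2.
  by rewrite jacE.
pose D0 := D (W *m a, 0).
pose B' := B - D0.1.2.
pose T0 := mx_of_sym (S0 - D0.2.1).
pose T1 := mx_of_sym (S1 - D0.2.2).
have T0t : T0^T = T0 by exact: tr_mx_of_sym.
have T1t : T1^T = T1 by exact: tr_mx_of_sym.
have S0E : S0 - D0.2.1 = p0 T0 by rewrite /p0/= /T0 /mx_of_sym vsvalK.
have S1E : S1 - D0.2.2 = p1 T1 by rewrite /p1/= /T1 /mx_of_sym vsvalK.
clearbody T0 T1.
(* A mixed block, from the range of [P0] to the normal directions: it produces [B'] in the tangency
   component and has no diagonal part, because [R0 W = 0] and [R0 R1^T = 0]. *)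
pose X := W *m B' *m R0.
have JX : jac h x *m X = B' *m R0 by rewrite /X !mulmxA JW mul1mx.
have XtV0 : X^T *m V0 = 0 by rewrite /X !trmx_mul -!mulmxA WV0 !mulmx0.
have R0X : R0 *m X = 0 by rewrite /X !mulmxA R0W !mul0mx.
have XR1 : X *m R1^T = 0 by rewrite /X -mulmxA R0R1 mulmx0.
clearbody X.
(* The minus sign compensates for the differential of [N] being minus the identity on the block of
   [Q0]. The transpose of [X] restores symmetry and is harmless, since [X^T V0 = 0]. *)
pose Z := V0 *m T0 *m V0^T - V1 *m T1 *m V1^T + (X + X^T).
have Zt : Z^T = Z.
  rewrite /Z [LHS]linearD/= [(_ - _)^T]linearB/= !trmx_mul !trmxK T0t T1t !mulmxA.
  by rewrite [(X + _)^T]linearD/= trmxK [X^T + X]addrC.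
have Zs : mx_of_sym (vsproj (sym_vspace R n) Z) = Z by exact: mx_of_sym_proj.
have JZ : jac h x *m Z *m V0 = B'.
  have ZV0 : Z *m V0 = V0 *m (T0 *m V0^T *m V0) + X *m V0.
    by rewrite /Z !mulmxDl mulNmx -(mulmxA _ V1^T) V1V0 mulmx0 subr0 XtV0 addr0 !mulmxA.
  by rewrite -mulmxA ZV0 mulmxDr mulmxA JV0 mul0mx add0r mulmxA JX -mulmxA RV0 mulmx1.
have P0R0 : P0 *m R0^T = R0^T by rewrite -{2}R0P0 trmx_mul P0t.
have P0R1 : P0 *m R1^T = 0 by rewrite -VR0 -mulmxA R0R1 mulmx0.
have Z0 : R0 *m (P0 *m Z + Z *m P0 - Z) *m R0^T = T0.
  have key (Y : 'M[R]_n) : R0 *m (P0 *m Y + Y *m P0 - Y) *m R0^T = R0 *m Y *m R0^T.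
    rewrite mulmxBr mulmxDr mulmxBl mulmxDl !mulmxA R0P0.
    by rewrite -[R0 *m Y *m P0 *m _]mulmxA P0R0 addrK.
  rewrite key /Z !mulmxDr mulmxN !mulmxA RV0 R0V1 R0X !mul0mx subr0 add0r mul1mx.
  rewrite mulmxDl -(mulmxA R0) -[X^T *m _]trmx_mul R0X trmx0 mulmx0 addr0.
  by rewrite -mulmxA -trmx_mul RV0 trmx1 mulmx1.
have Z1 : R1 *m (P0 *m Z + Z *m P0 - Z) *m R1^T = T1.
  have key (Y : 'M[R]_n) : R1 *m (P0 *m Y + Y *m P0 - Y) *m R1^T = - (R1 *m Y *m R1^T).
    rewrite mulmxBr mulmxDr mulmxBl mulmxDl !mulmxA R1P0 !mul0mx.
    by rewrite -[R1 *m Y *m P0 *m _]mulmxA P0R1 mulmx0 addr0 add0r.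
  rewrite key /Z !mulmxDr mulmxN !mulmxA R1V0 !mul0mx RV1 mul1mx add0r.
  rewrite !mulmxDl mulNmx -(mulmxA R1) XR1 mulmx0 add0r -(mulmxA T1) -trmx_mul RV1.
  by rewrite -[R1 *m X^T]trmxK trmx_mul trmxK XR1 trmx0 mul0mx addr0 trmx1 mulmx1 opprK.
have D2 : D (0, vsproj (sym_vspace R n) Z) = ((0, B'), (S0 - D0.2.1, S1 - D0.2.2)).
  apply: (is_diff_quadratic (z := ((0, 0),
    (p0 (R0 *m (Z *m Z) *m R0^T), p1 (R1 *m (Z *m Z) *m R1^T)))) dF) => t.
  rewrite S0E S1E.
  have lineE : mx_of_sym (P0s + t *: vsproj (sym_vspace R n) Z) = P0 + t *: Z.
    by rewrite -[in RHS]Zs.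
  have NE (Y : 'M[R]_n) :
      N (P0 + t *: Y) = N P0 + t *: (P0 *m Y + Y *m P0 - Y) + t ^+ 2 *: (Y *m Y).
    rewrite /N mulmxDl !mulmxDr -!scalemxAr -!scalemxAl scalerA.
    by apply/matrixP => i j; rewrite !mxE; ring.
  have RNE q (Q : 'M[R]_(q, n)) (Y : 'M[R]_n) : Q *m N (P0 + t *: Y) *m Q^T =
      Q *m N P0 *m Q^T + t *: (Q *m (P0 *m Y + Y *m P0 - Y) *m Q^T)
      + t ^+ 2 *: (Q *m (Y *m Y) *m Q^T).
    rewrite NE; move: (N P0) (P0 *m Y + _ - Y) (Y *m Y) => A1 A2 A3.
    by rewrite !mulmxDr !mulmxDl -!scalemxAr -!scalemxAl.
  rewrite [RHS](_ : _ = ((h x + t *: 0 + t ^+ 2 *: 0,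
    jac h x *m P0 *m V0 + t *: B' + t ^+ 2 *: 0),
    (p0 (R0 *m N P0 *m R0^T) + t *: p0 T0 + t ^+ 2 *: p0 (R0 *m (Z *m Z) *m R0^T),
     p1 (R1 *m N P0 *m R1^T) + t *: p1 T1 + t ^+ 2 *: p1 (R1 *m (Z *m Z) *m R1^T))))//.
  rewrite [LHS](_ : _ = let P := mx_of_sym (P0s + t *: vsproj (sym_vspace R n) Z) in
    ((h (x + t *: 0), jac h (x + t *: 0) *m P *m V0),
     (p0 (R0 *m N P *m R0^T), p1 (R1 *m N P *m R1^T))))//.
  rewrite lineE; cbv zeta; rewrite !RNE Z0 Z1 !scaler0 !addr0.
  rewrite mulmxDr mulmxDl -scalemxAr -scalemxAl JZ.
  by rewrite -!linearZ -!linearD.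
exists (W *m a, vsproj (sym_vspace R n) Z).
rewrite (_ : (W *m a, vsproj _ Z) =
  (W *m a, 0) + (0, vsproj (sym_vspace R n) Z)); last first.
  by congr (_, _); rewrite ?addr0 ?add0r.
have D0a : D0.1.1 = a by rewrite D1 mulmxA JW mul1mx.
rewrite linearD D2 -/D0 [D0]surjective_pairing [D0.1]surjective_pairing D0a.
rewrite [D0.2]surjective_pairing.
by congr (_, _, (_, _)); rewrite ?addr0// addrC subrK.
Qed.

End Grassmann.

Theorem lemma1 (R : realType) (n d k : nat) (M : set 'cV[R]_n)
    (g : 'cV[R]_n -> 'cV[R]_n -> 'cV[R]_n -> R)
    (hM : embedded_riemannian_submanifold (@frobenius R n 1) M g d)
    (hk : (1 <= k < d)%N) :
  embedded_riemannian_submanifold (@ip_stiefel R n k)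
    (stiefel_bundle k M) (fun=> @ip_stiefel R n k)
    (d + k * d - (k * (k + 1)) %/ 2)%N
  /\
  embedded_riemannian_submanifold (@ip_grassmann R n)
    (grassmann_bundle k M) (fun=> @ip_grassmann R n)
    (d + k * (d - k))%N.
Proof.
have [Md _] := hM; have kd : (k <= d)%N by case/andP: hk => _ /ltnW.
(* The metrics on the bundles are the ambient inner products themselves, so the metric clauses hold
   by reflexivity. *)
split; split=> //; first exact: stiefel_bundle_submanifold.
exact: grassmann_bundle_submanifold.
Qed.
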